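(* Let $\mathbf{n}=\{n_j:j\in\mathbb{N}\}$ be a $\theta$-lacunary sequence of positive integers, and let $\mathsf{W}^\star_{\mathbf{n}}f(x):=\sup_{n\in\mathbf{n}}|\mathsf{W}_nf(x)|$. There is a positive constant $K$, depending only on the lacunarity constant $\theta$ of $\mathbf{n}$, such that for all $1<p\le2$ and all $f\in L^p(\mathbb{T})$ $$\|\mathsf{W}^\star_{\mathbf{n}}f\|_{p,\infty}\le K\,\log_1(p')\,\|f\|_p .$$
   Context: $\mathbb{T}=\mathbb{R}/\mathbb{Z}$ is identified with $[0,1)$ with Lebesgue measure; $\langle f,g\rangle=\int_{\mathbb{T}}f(x)\overline{g(x)}\,dx$; functions are complex valued. $\mathbb{N}=\{0,1,2,\dots\}$. Walsh functions: for $n\in\mathbb{N}$, $W_n(x)=\prod_{k\in\mathbb{N}}\big(\mathrm{sign}\,\sin(2^k2\pi x)\big)^{\varepsilon_k(n)}$, where $\varepsilon_k(n)=\lfloor 2^{-k}n\rfloor \bmod 2$. Walsh-Fourier partial sums: $\mathsf{W}_nf(x)=\sum_{k=0}^n\langle f,W_k\rangle W_k(x)$. A sequence $\{n_j:j\in\mathbb{N}\}$ of positive integers is $\theta$-lacunary (with lacunarity constant $\theta$) if $\inf_{j}\frac{n_{j+1}}{n_j}=\theta>1$. $\log_1(t)=\log(e+t)$; $p'=p/(p-1)$; $\|h\|_{p,\infty}=\sup_{\lambda>0}\lambda|\{x\in\mathbb{T}:|h(x)|>\lambda\}|^{1/p}$. *)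

(* Defs.v *)
From HB Require Import structures.
From mathcomp Require Import all_boot all_order all_algebra.
From mathcomp Require Import all_classical all_reals all_analysis.
From mathcomp Require Import complex.

Set Implicit Arguments.
Unset Strict Implicit.
Unset Printing Implicit Defensive.

Import Order.TTheory GRing.Theory Num.Theory.
Import numFieldNormedType.Exports.

Local Open Scope classical_set_scope.
Local Open Scope ring_scope.

(* The torus is identified with [0, 1): a function on it is a function on R
   of which only the values on this interval matter. *)
Definition torus {R : realType} : set R := `[0, 1[.

(* The library has no measurable structure on R[i], hence the componentwise
   definitions of measurability and of the integral. *)
Definition cmeasurable {R : realType} (f : R -> R[i]) : Prop :=
  measurable_fun torus (fun x => complex.Re (f x)) /\
  measurable_fun torus (fun x => complex.Im (f x)).

Definition cintegral {R : realType} (f : R -> R[i]) : R[i] :=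
  Complex (\int[lebesgue_measure]_(x in torus) complex.Re (f x))
          (\int[lebesgue_measure]_(x in torus) complex.Im (f x)).

Definition inner {R : realType} (f g : R -> R[i]) : R[i] :=
  cintegral (fun x => f x * conjc (g x)).

(* Normc.normc is the R-valued modulus on R[i]. *)
Definition Lpnorm {R : realType} (p : R) (f : R -> R[i]) : \bar R :=
  'N[lebesgue_measure]_(p%:E)[(fun x => (Normc.normc (f x))%:E) \_ torus].

(* As usual, elements of L^p are handled through Borel representatives. *)
Definition in_Lp {R : realType} (p : R) (f : R -> R[i]) : Prop :=
  cmeasurable f /\ (Lpnorm p f < +oo)%E.

Definition weak_Lpnorm {R : realType} (p : R) (h : R -> \bar R) : \bar R :=
  ereal_sup [set (lambda%:E *
      poweR (lebesgue_measure (torus `&` [set x | (lambda%:E < `|h x|)%E])) p^-1)%E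
    | lambda in [set lambda : R | 0 < lambda]].

Definition bit (k n : nat) : nat := ((n %/ 2 ^ k) %% 2)%N.

Lemma bit_ge (k n : nat) : (n <= k)%N -> bit k n = 0%N.
Proof.
by move=> nk; rewrite /bit divn_small// (leq_ltn_trans nk)// ltn_expl.
Qed.

(* By bit_ge, all the factors with index k >= n of the infinite product
   are equal to 1. *)
Definition walsh {R : realType} (n : nat) (x : R) : R :=
  \prod_(k < n) Num.sg (sin (2 ^+ k * (2 * pi * x))) ^+ bit k n.

Definition cwalsh {R : realType} (n : nat) (x : R) : R[i] := (walsh n x)%:C%C.

Definition walsh_sum {R : realType} (n : nat) (f : R -> R[i]) (x : R) : R[i] :=
  \sum_(0 <= k < n.+1) inner f (cwalsh k) * cwalsh k x.

Definition walsh_max {R : realType} (n_ : nat -> nat) (f : R -> R[i]) (x : R) :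
    \bar R :=
  ereal_sup [set (Normc.normc (walsh_sum n f x))%:E | n in range n_].

Definition lacunary {R : realType} (theta : R) (n_ : nat -> nat) : Prop :=
  [/\ forall j, (0 < n_ j)%N,
      inf (range (fun j => (n_ j.+1)%:R / (n_ j)%:R)) = theta
    & 1 < theta].

Definition log1 {R : realType} (t : R) : R := ln (expR 1 + t).

Definition conj_exponent {R : realType} (p : R) : R := p / (p - 1).

(* Main.v *)
Require Import Defs.
From mathcomp Require Import all_boot all_order all_algebra.
From mathcomp Require Import all_classical all_reals all_analysis.
From mathcomp Require Import measurable_realfun complex.
From mathcomp Require Import ring lra zify.

(** Write n_j + 1 = N and let E_k be the conditional expectation on the dyadic
intervals of length 2^-k, D_k = E_{k+1} - E_k. If 2^k <= N < 2^{k+1}, the sum of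
the first N terms of the Walsh series of f is E_k f + W_N F_N, where
F_N = sum of D_i (f W_N) over the i < k such that the binary digit i of N is 1
[walsh_partial_sum_block]: up to the sign W_N, it is a martingale transform of
the modulated function f W_N. At most L of the N lie in one block
[2^k, 2^{k+1}[ as soon as theta^L >= 4, and the sequence splits into L
sequences with at most one N = N_k in each block [lacunary_block_selection]. It
also suffices to treat the real and imaginary parts, and finitely many indices,
which turns everything into a statement about functions on the leaves of a
finite binary tree, the leaves being the dyadic cells of some small length.

On the tree, let the martingales be stopped at the first node where the mean of
|f|^p exceeds alpha^p. The stopped leaves have total mass at most
alpha^-p ||f||_p^p, and elsewhere |E_k f| <= alpha. The stopped martingale of
f W_N is bounded by 2 alpha, whatever N is, so its transform has exponential
tails. In fact a Bellman function gives
    |{ |F_N| > lambda }| <= C exp(- c lambda / alpha) alpha^-2 ||F_N||_2^2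
[transform_exp_le], with the L^2 norm on the right, which is what can be summed
over N; here and below F_N is the transform of the stopped
martingale. For the sum of the ||F_N||_2^2, the energy of the transform is at most
that of the stopped martingale at time k [quadratic_mean_le]. If the node of
depth k is not stopped this is the energy of D_k f, because W_N is the k-th
Rademacher function times a function of the first k digits; summed over k it is
at most the energy of the stopped f. If the martingale is stopped by time k, it
is the square of the coefficient of f on W_{N_k} in the stopped interval. These
Walsh functions are lacunary, so that by a Rudin type inequality the sum of the
squares is O(p'^2 alpha^2) [lacunary_walsh_coeff_le]. Altogether
    sum of ||F_N||_2^2 <= C p'^2 alpha^{2-p} ||f||_p^p.
The factor p'^2 is harmless: for alpha = lambda / A with A a multiple of
log_1(p'), the factor exp(- c A) absorbs it, and only the A^p that comes from
the stopping remains [dyadic_lacunary_maximal]. This is how p' turns into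
log_1(p').

The tree inequality returns to the torus through the averages of f over the
cells: the Walsh functions are constant inside the cells, so that the partial
sums agree off the finitely many end points, and Jensen's inequality bounds the
L^p norm of the averages. *)

Set Implicit Arguments.
Unset Strict Implicit.
Unset Printing Implicit Defensive.

Import Order.TTheory GRing.Theory Num.Theory.
Local Open Scope ring_scope.

(** * Means over the binary tree and optional stopping *)

(** A node of the binary tree is the word of its binary digits, so that the node
[s] stands for the dyadic interval of points whose expansion starts with [s]. A
random path starts at [s] and takes at most [n] further digits, but halts at the
first node that is not [live]; this is the mean of [Phi] at the node where it
halts. With [predT] it is the mean over the descendants of depth [n]. *)
Fixpoint stopped_mean {R : realType} (live : pred (seq bool)) (n : nat)
    (Phi : seq bool -> R) (s : seq bool) : R :=
  if n is n'.+1 then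
    if live s then
      (stopped_mean live n' Phi (rcons s false) +
       stopped_mean live n' Phi (rcons s true)) / 2
    else Phi s
  else Phi s.

Notation mean := (stopped_mean predT).

(** The conditional expectation at [s] of a function of the leaves, which are the
nodes of depth [M]. *)
Definition node {R : realType} (M : nat) (phi : seq bool -> R) (s : seq bool) : R :=
  mean (M - size s) phi s.

Definition martingale {R : realType} (M : nat) (A : seq bool -> R) : Prop :=
  forall s, (size s < M)%N -> A s = (A (rcons s false) + A (rcons s true)) / 2.

(** The nodes that a path from the root can visit before or when it halts. *)
Definition reached (live : pred (seq bool)) (s : seq bool) : Prop :=
  forall i, (i < size s)%N -> live (take i s).

Lemma reached_rcons live s b : reached live s -> live s -> reached live (rcons s b).
Proof.
move=> rs ls i; rewrite size_rcons ltnS leq_eqVlt => /predU1P[->|ilt].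
  by rewrite -cats1 takel_cat// take_size.
by rewrite -cats1 takel_cat ?rs// ltnW.
Qed.

(** Optional stopping for supermartingales. All the estimates on the tree reduce to
it, through the choice of [Y]. *)
Lemma stopped_mean_le {R : realType} (live : pred (seq bool)) (M n : nat)
    (Phi Y : seq bool -> R) (s : seq bool) :
  (size s + n = M)%N -> reached live s ->
  (forall u, reached live u -> live u -> (size u < M)%N ->
    (Y (rcons u false) + Y (rcons u true)) / 2 <= Y u) ->
  (forall u, reached live u -> (size u <= M)%N ->
    (live u -> size u = M) -> Phi u <= Y u) ->
  stopped_mean live n Phi s <= Y s.
Proof.
move=> + + super stop; elim: n s => [|n IH] s /= sM rs.
  by apply: stop => //; rewrite -sM addn0.
case: ifPn => ls; last by apply: stop => //; rewrite -?sM ?leq_addr// (negPf ls).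
have lt : (size s < M)%N by rewrite -sM addnS ltnS leq_addr.
apply: le_trans (super s rs ls lt).
rewrite ler_pM2r ?invr_gt0// lerD// IH ?size_rcons -?sM ?addSnnS//;
  exact: reached_rcons.
Qed.

Lemma stopped_meanN {R : realType} live n (Phi : seq bool -> R) s :
  stopped_mean live n (fun u => - Phi u) s = - stopped_mean live n Phi s.
Proof. by elim: n s => //= n IH s; rewrite !IH; case: ifP => // _; field. Qed.

Lemma stopped_meanD {R : realType} live n (Phi Psi : seq bool -> R) s :
  stopped_mean live n (fun u => Phi u + Psi u) s =
  stopped_mean live n Phi s + stopped_mean live n Psi s.
Proof. by elim: n s => //= n IH s; rewrite !IH; case: ifP => // _; field. Qed.

Lemma stopped_meanZ {R : realType} live n c (Phi : seq bool -> R) s :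
  stopped_mean live n (fun u => c * Phi u) s = c * stopped_mean live n Phi s.
Proof. by elim: n s => //= n IH s; rewrite !IH; case: ifP => // _; field. Qed.

Lemma stopped_mean_sum {R : realType} live n m (Phi : nat -> seq bool -> R) s :
  stopped_mean live n (fun u => \sum_(k < m) Phi k u) s =
  \sum_(k < m) stopped_mean live n (Phi k) s.
Proof.
elim: m => [|m IH].
  rewrite big_ord0 -[RHS](mul0r (stopped_mean live n (fun=> 0) s)) -stopped_meanZ.
  by congr stopped_mean; apply/funext => u; rewrite big_ord0 mul0r.
rewrite big_ord_recr/= -IH -stopped_meanD; congr stopped_mean.
by apply/funext => u; rewrite big_ord_recr.
Qed.

Lemma mean_cst {R : realType} n (c : R) s : mean n (fun=> c) s = c.
Proof. by elim: n s => //= n IH s; rewrite !IH; field. Qed.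

Lemma stopped_mean_mono {R : realType} (live : pred (seq bool)) (M n : nat)
    (Phi Psi : seq bool -> R) (s : seq bool) :
  (size s + n = M)%N -> reached live s ->
  (forall u, reached live u -> (size u <= M)%N ->
    (live u -> size u = M) -> Phi u <= Psi u) ->
  stopped_mean live n Phi s <= stopped_mean live n Psi s.
Proof.
move=> + + stop; elim: n s => [|n IH] s /= sM rs.
  by apply: stop => //; rewrite -sM addn0.
case: ifPn => ls; last by apply: stop => //; rewrite -?sM ?leq_addr// (negPf ls).
rewrite ler_pM2r ?invr_gt0// lerD// IH ?size_rcons -?sM ?addSnnS//;
  exact: reached_rcons.
Qed.

Lemma stopped_mean_martingale {R : realType} (live : pred (seq bool)) (M n : nat)
    (A : seq bool -> R) (s : seq bool) :
  martingale M A -> (size s + n = M)%N -> stopped_mean live n A s = A s.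
Proof.
move=> mA; elim: n s => //= n IH s sM; case: ifPn => // ls.
by rewrite [RHS]mA -?sM ?addnS ?ltnS ?leq_addr// !IH ?size_rcons -?sM ?addSnnS.
Qed.

Lemma mean_eq {R : realType} (M n : nat) (Phi Psi : seq bool -> R) s :
  (size s + n = M)%N -> (forall u, size u = M -> Phi u = Psi u) ->
  mean n Phi s = mean n Psi s.
Proof.
move=> sM e; apply/eqP; rewrite eq_le.
by rewrite !(stopped_mean_mono sM)// => u _ _ uM; rewrite e ?uM.
Qed.

Lemma node_martingale {R : realType} M (phi : seq bool -> R) :
  martingale M (node M phi).
Proof.
by move=> s sM; rewrite /node !size_rcons -(subnSK sM).
Qed.

Lemma node_mono {R : realType} M (phi psi : seq bool -> R) s :
  (size s <= M)%N -> (forall u, size u = M -> phi u <= psi u) ->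
  node M phi s <= node M psi s.
Proof.
move=> sM le; apply: (stopped_mean_mono (M := M)) => //.
  by rewrite subnKC.
by move=> u _ _ /(_ isT); exact: le.
Qed.

Lemma node_eq {R : realType} M (phi psi : seq bool -> R) s :
  (size s <= M)%N -> (forall u, size u = M -> phi u = psi u) ->
  node M phi s = node M psi s.
Proof. by move=> sM e; apply: (mean_eq (M := M)) => //; rewrite subnKC. Qed.
(** * Walsh functions on the tree *)

(** The digits after the end of [s] do not enter, hence this is the Walsh function
on the interval of [s] only if [n < 2 ^ size s]; on a shorter word it is the part
of the product that is already determined. *)
Definition walsh_node {R : realType} (n : nat) (s : seq bool) : R :=
  \prod_(k < size s) ((-1) ^+ nth false s k) ^+ bit k n.

Lemma walsh_node_rcons {R : realType} n s b :
  walsh_node n (rcons s b) = walsh_node n s * ((-1) ^+ b) ^+ bit (size s) n :> R.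
Proof.
rewrite /walsh_node size_rcons big_ord_recr/= nth_rcons ltnn eqxx; congr (_ * _).
by apply: eq_bigr => k _; rewrite nth_rcons ltn_ord.
Qed.

Lemma walsh_node_sq {R : realType} n s : walsh_node n s ^+ 2 = 1 :> R.
Proof.
rewrite /walsh_node -prodrXl big1// => k _.
by rewrite -(exprM (-1)) sqrr_sign.
Qed.

Lemma walsh_node_norm {R : realType} n s : `|walsh_node n s| = 1 :> R.
Proof.
by apply/eqP; rewrite -(@eqrXn2 _ 2)// -normrX walsh_node_sq normr1 expr1n.
Qed.

Lemma bit_small k n : (n < 2 ^ k)%N -> bit k n = 0%N.
Proof. by move=> nk; rewrite /bit divn_small. Qed.

Lemma bit_lead k n : (2 ^ k <= n < 2 ^ k.+1)%N -> bit k n = 1%N.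
Proof.
move=> /andP[kn nk]; rewrite /bit (_ : (n %/ 2 ^ k)%N = 1%N)//.
have k0 : (0 < 2 ^ k)%N by rewrite expn_gt0.
apply/eqP; rewrite eqn_leq leq_divRL// mul1n kn andbT -ltnS ltn_divLR//.
by rewrite -expnS.
Qed.

Lemma walsh_node_rcons_small {R : realType} n s b :
  (n < 2 ^ size s)%N -> walsh_node n (rcons s b) = walsh_node n s :> R.
Proof. by move=> ns; rewrite walsh_node_rcons bit_small// expr0 mulr1. Qed.

Lemma walsh_node_rcons_lead {R : realType} n s b :
  (2 ^ size s <= n < 2 ^ (size s).+1)%N ->
  walsh_node n (rcons s b) = walsh_node n s * (-1) ^+ b :> R.
Proof. by move=> ns; rewrite walsh_node_rcons bit_lead// expr1. Qed.

(** The value at [s] of the martingale transform of [H] by the predictable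
sequence [e] with values 0 and 1. Since the node [s] contains its history, the
transform is again a function of nodes. *)
Definition transform {R : realType} (e : pred nat) (H : seq bool -> R) s : R :=
  \sum_(i < size s) (e i)%:R * (H (take i.+1 s) - H (take i s)).

Definition quadratic {R : realType} (e : pred nat) (H : seq bool -> R) s : R :=
  \sum_(i < size s) (e i)%:R * (H (take i.+1 s) - H (take i s)) ^+ 2.

(** * Martingale transforms and their exponential integrability *)

Lemma take_rcons {T : Type} i (s : seq T) b :
  (i <= size s)%N -> take i (rcons s b) = take i s.
Proof. by move=> ile; rewrite -cats1 takel_cat. Qed.

Lemma take_rcons_size {T : Type} (s : seq T) b : take (size s) (rcons s b) = s.
Proof. by rewrite take_rcons// take_size. Qed.

Lemma take_rcons_full {T : Type} (s : seq T) b :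
  take (size s).+1 (rcons s b) = rcons s b.
Proof. by rewrite -(size_rcons s b) take_size. Qed.

Lemma transform_rcons {R : realType} e (H : seq bool -> R) s b :
  transform e H (rcons s b) =
  transform e H s + (e (size s))%:R * (H (rcons s b) - H s).
Proof.
rewrite /transform size_rcons big_ord_recr/= take_rcons_size take_rcons_full.
congr (_ + _).
by apply: eq_bigr => i _; rewrite !take_rcons// ltnW.
Qed.

Lemma quadratic_rcons {R : realType} e (H : seq bool -> R) s b :
  quadratic e H (rcons s b) =
  quadratic e H s + (e (size s))%:R * (H (rcons s b) - H s) ^+ 2.
Proof.
rewrite /quadratic size_rcons big_ord_recr/= take_rcons_size take_rcons_full.
congr (_ + _).
by apply: eq_bigr => i _; rewrite !take_rcons// ltnW.
Qed.

Lemma expR_le_quadratic {R : realType} (y : R) : `|y| <= 1 / 2 ->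
  expR y <= 1 + y + 2 * y ^+ 2.
Proof.
rewrite ler_norml => /andP[y1 y2].
have h : 1 - y <= expR (- y) by have := expR_ge1Dx (- y); lra.
rewrite expRN in h; have e0 := expR_gt0 y.
have : (1 - y) * expR y <= 1 by rewrite -ler_pdivlMr// mul1r.
have : 1 <= (1 - y) * (1 + y + 2 * y ^+ 2) by nra.
move=> a b; have : (1 - y) * expR y <= (1 - y) * (1 + y + 2 * y ^+ 2) by lra.
by rewrite ler_pM2l//; lra.
Qed.

(** The scale 8 makes the step inequality of the Bellman function below hold with
room to spare. *)
Definition cosh_excess {R : realType} (x : R) : R :=
  (expR (x / 8) + expR (- (x / 8))) / 2 - 1.

Lemma cosh_excess0 {R : realType} : cosh_excess 0 = 0 :> R.
Proof. by rewrite /cosh_excess mul0r oppr0 expR0; lra. Qed.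

Lemma cosh_excess_ge0 {R : realType} (x : R) : 0 <= cosh_excess x.
Proof.
by rewrite /cosh_excess; have := expR_ge1Dx (x / 8); have := expR_ge1Dx (- (x / 8)); lra.
Qed.

(** Both terms move: the convexity of cosh and the correlation of the two moves
cost at most (9/16) d^2 cosh (F / 8), while the concave weight [2 - H ^+ 2], which
lies between 1 and 2, gains [d ^+ 2 * cosh_excess F] = d^2 (cosh (F / 8) - 1).
The difference is at most d^2. *)
Lemma cosh_excess_step {R : realType} (H F d : R) :
  `|H + d| <= 1 -> `|H - d| <= 1 ->
  ((2 - (H + d) ^+ 2) * cosh_excess (F + d) +
   (2 - (H - d) ^+ 2) * cosh_excess (F - d)) / 2 <=
  (2 - H ^+ 2) * cosh_excess F + d ^+ 2.
Proof.
rewrite !ler_norml => /andP[h1 h2] /andP[h3 h4].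
set x := expR (F / 8); set x' := expR (- (F / 8)).
set z := d / 8; have dz : d = 8 * z by rewrite /z; field.
have z1 : `|z| <= 1 / 8 by rewrite ler_norml; apply/andP; split; lra.
set y := expR z; set y' := expR (- z).
have yu : y <= 1 + z + 2 * z ^+ 2 by apply: expR_le_quadratic; lra.
have y'u : y' <= 1 - z + 2 * z ^+ 2.
  by rewrite -[X in _ + 2 * X]sqrrN; apply: expR_le_quadratic; rewrite normrN; lra.
have yl : 1 + z <= y by exact: expR_ge1Dx.
have y'l : 1 - z <= y' by exact: expR_ge1Dx.
have x0 : 0 < x by exact: expR_gt0.
have x'0 : 0 < x' by exact: expR_gt0.
pose C := (x + x') / 2; pose S := (x - x') / 2.
pose c := (y + y') / 2; pose t := (y - y') / 2.
have -> : cosh_excess (F + d) = C * c + S * t - 1.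
  rewrite /cosh_excess (mulrDl F d) opprD !expRD -/z -/x -/x' -/y -/y'.
  by rewrite /C /S /c /t; field.
have -> : cosh_excess (F - d) = C * c - S * t - 1.
  rewrite /cosh_excess (mulrDl F (- d)) mulNr opprD opprK !expRD -/z -/x -/x' -/y -/y'.
  by rewrite /C /S /c /t; field.
have -> : cosh_excess F = C - 1 by [].
have -> : ((2 - (H + d) ^+ 2) * (C * c + S * t - 1) +
  (2 - (H - d) ^+ 2) * (C * c - S * t - 1)) / 2 =
  (2 - H ^+ 2 - d ^+ 2) * (C * c - 1) - 2 * H * d * (S * t) by field.
have C0 : 0 <= C by rewrite /C; lra.
have SC : `|S| <= C by rewrite ler_norml /S /C; apply/andP; split; lra.
have c1 : c <= 1 + 2 * z ^+ 2 by rewrite /c; lra.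
have t1 : `|t| <= 2 * `|z|.
  have : `|t| <= `|z| + z ^+ 2.
    have z2 : 0 <= z ^+ 2 by exact: sqr_ge0.
    have := ler_norm z; have := ler_norm (- z); rewrite normrN => zn zp.
    rewrite ler_norml /t; apply/andP; split; lra.
  rewrite -real_normK ?num_real//; have := normr_ge0 z; nra.
have Hd : 0 <= 2 - H ^+ 2 - d ^+ 2 by nra.
have H1 : `|H| <= 1 by rewrite ler_norml; apply/andP; split; lra.
have cross : - (2 * H * d * (S * t)) <= 32 * C * z ^+ 2.
  apply: le_trans (ler_norm _) _; rewrite normrN.
  have -> : `|2 * H * d * (S * t)| = 2 * `|H| * (8 * `|z|) * (`|S| * `|t|).
    by rewrite dz !normrM !normr_nat.
  have st : `|S| * `|t| <= C * (2 * `|z|) by apply: ler_pM.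
  have hz : 2 * `|H| * (8 * `|z|) <= 16 * `|z|.
    by have := normr_ge0 z; have := normr_ge0 H; nra.
  apply: (@le_trans _ _ ((16 * `|z|) * (C * (2 * `|z|)))).
    by apply: ler_pM => //; rewrite !mulr_ge0.
  by rewrite -[z ^+ 2]real_normK ?num_real//; lra.
have main : (2 - H ^+ 2 - d ^+ 2) * (C * c - 1) <=
    (2 - H ^+ 2 - d ^+ 2) * (C - 1 + 2 * C * z ^+ 2).
  by apply: ler_wpM2l => //; nra.
have z2 : 0 <= z ^+ 2 by exact: sqr_ge0.
have Cz : 0 <= C * z ^+ 2 by exact: mulr_ge0.
have : (2 - H ^+ 2 - d ^+ 2) * (2 * C * z ^+ 2) <= 2 * (2 * C * z ^+ 2).
  by apply: ler_wpM2r; [lra|have := sqr_ge0 H; have := sqr_ge0 d; lra].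
rewrite dz exprMn in main cross *; lra.
Qed.

(** The right-hand side is the squared L^2 norm of the transform. It would be
useless to have the constant 1 there: the bound is summed over many transforms
that are small in L^2. The supermartingale is the Bellman function
[(2 - H ^+ 2) * cosh_excess F] minus the quadratic variation. *)
Lemma transform_exp_le {R : realType} (live : pred (seq bool)) M e
    (H : seq bool -> R) :
  martingale M H ->
  (forall s, reached live s -> (size s <= M)%N -> `|H s| <= 1) ->
  stopped_mean live M (fun s => cosh_excess (transform e H s)) [::] <=
  stopped_mean live M (quadratic e H) [::].
Proof.
move=> mH H1; rewrite -subr_le0 -stopped_meanN -stopped_meanD.
pose Y s := (2 - H s ^+ 2) * cosh_excess (transform e H s) - quadratic e H s.
have <- : Y [::] = 0.
  by rewrite /Y /transform /quadratic !big_ord0 cosh_excess0 mulr0 subr0.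
apply: (stopped_mean_le (M := M)) => // u ru.
  move=> lu uM; rewrite /Y !transform_rcons !quadratic_rcons.
  have := H1 _ (reached_rcons (b := false) ru lu); rewrite size_rcons => /(_ uM).
  have := H1 _ (reached_rcons (b := true) ru lu); rewrite size_rcons => /(_ uM).
  have := mH _ uM.
  set H0 := H (rcons u false); set H2 := H (rcons u true) => Hu.
  pose d := (H0 - H2) / 2.
  have -> : H0 = H u + d by rewrite Hu /d; field.
  have -> : H2 = H u - d by rewrite Hu /d; field.
  move=> b1 b0; set F := transform e H u; set V := quadratic e H u.
  have -> : H u + d - H u = d by ring.
  have -> : H u - d - H u = - d by ring.
  rewrite sqrrN.
  case: (e (size u)) => /=; rewrite ?mulr1n ?mulr0n.
    by have := cosh_excess_step F b0 b1; rewrite !mul1r; lra.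
  by rewrite !mul0r !addr0; have := mulr_ge0 (sqr_ge0 d) (cosh_excess_ge0 F); lra.
move=> uM _; rewrite /Y lerD2r -[leLHS]mul1r ler_wpM2r ?cosh_excess_ge0//.
have : H u ^+ 2 <= 1 by rewrite -real_normK ?num_real// expr_le1// H1.
lra.
Qed.

(** Orthogonality of the increments: [quadratic - H ^+ 2] at time [k] is a
supermartingale, which is nonpositive at the root. *)
Lemma quadratic_mean_le {R : realType} (live : pred (seq bool)) M k (e : pred nat)
    (H : seq bool -> R) :
  martingale M H -> (forall i, (i < M)%N -> e i -> (i < k)%N) ->
  stopped_mean live M (quadratic e H) [::] <=
  stopped_mean live M (fun s => H (take k s) ^+ 2) [::].
Proof.
move=> mH ek; rewrite -subr_le0 -stopped_meanN -stopped_meanD.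
pose Y s := quadratic e H s - H (take k s) ^+ 2.
apply: (@le_trans _ _ (Y [::])); last first.
  by rewrite /Y /quadratic big_ord0 sub0r oppr_le0 sqr_ge0.
apply: (stopped_mean_le (M := M)) => // u ru lu uM; rewrite /Y !quadratic_rcons.
case: (leqP k (size u)) => ku.
  rewrite !take_rcons//; have /negPf -> : ~~ e (size u).
    by apply/negP => /(ek _ uM); rewrite ltnNge ku.
  by rewrite mulr0n !mul0r; lra.
rewrite !(@take_oversize _ k) ?size_rcons//; last exact: ltnW.
rewrite (mH _ uM).
have := sqr_ge0 (H (rcons u false) - H (rcons u true)).
by case: (e _) => /=; rewrite ?mulr0n ?mulr1n ?mul0r ?mul1r; lra.
Qed.

(** * Coefficients on lacunary Walsh functions *)

(** If 2^k <= N_k < 2^{k+1}, then W_{N_k} is a sign known at depth k times an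
independent fair sign, so the exponential moment factorizes along the path, as
for Rademacher sums. At the node [s] the first part of the sum is known. *)
Lemma walsh_exp_mean {R : realType} M n (N : nat -> nat) (c : nat -> R) s :
  (forall k, 2 ^ k <= N k < 2 ^ k.+1)%N -> (forall k, `|c k| <= 1 / 2) ->
  (size s + n = M)%N ->
  mean n (fun u => expR (\sum_(k < M) c k * walsh_node (N k) u)) s <=
  expR (\sum_(k < size s) c k * walsh_node (N k) s +
        \sum_(size s <= k < M) 2 * c k ^+ 2).
Proof.
move=> hN hc sM.
apply: (stopped_mean_le (M := M) (Y := fun s =>
  expR (\sum_(k < size s) c k * walsh_node (N k) s +
        \sum_(size s <= k < M) 2 * c k ^+ 2))) => // u _.
  move=> _ uM; rewrite !size_rcons !big_ord_recr/= [in leRHS]big_ltn//.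
  set X := \sum_(k < _) c k * walsh_node (N k) u; set Z := \sum_(_ <= k < _) _.
  have eX b : \sum_(i < size u) c i * walsh_node (N i) (rcons u b) = X.
    apply: eq_bigr => i _; rewrite walsh_node_rcons_small//.
    by have /andP[_ lt] := hN i; apply: (leq_trans lt); rewrite leq_exp2l.
  rewrite !eX !walsh_node_rcons_lead// expr0 expr1 mulr1 mulrN1 mulrN.
  set w := c _ * _.
  have w1 : `|w| <= 1 / 2 by rewrite normrM walsh_node_norm mulr1.
  have ww : c (size u) ^+ 2 = w ^+ 2 by rewrite exprMn walsh_node_sq mulr1.
  rewrite ww !expRD.
  have e1 := expR_le_quadratic w1.
  have e2 : expR (- w) <= 1 - w + 2 * w ^+ 2.
    by rewrite -[X in _ + 2 * X]sqrrN; apply: expR_le_quadratic; rewrite normrN.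
  have e3 := expR_ge1Dx (2 * w ^+ 2).
  have XZ : 0 <= expR X * expR Z by rewrite mulr_ge0// expR_ge0.
  have : expR X * expR Z * ((expR w + expR (- w)) / 2) <=
      expR X * expR Z * expR (2 * w ^+ 2) by apply: ler_wpM2l => //; lra.
  lra.
by move=> uM /(_ isT) us; rewrite us big_geq// addr0.
Qed.
(** Duality. Let b_k be the coefficients, S^2 the sum of their squares and v the
combination of the W_{N_k} with coefficients c_k = b_k / 2S, so that the mean of
a v is S / 2. By Young's inequality and y^q <= exp(q y), |a v| is at most
q (|a|^p + exp |v|), and the exponential moment of v is bounded because the sum of
the c_k^2 is 1/4. The growth in q is not optimal, but any power of q would do. *)
Lemma lacunary_walsh_coeff_le {R : realType} M (N : nat -> nat) (p q : R)
    (a : seq bool -> R) s :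
  1 < p -> 1 < q -> p^-1 + q^-1 = 1 ->
  (forall k, 2 ^ k <= N k < 2 ^ k.+1)%N -> (size s <= M)%N ->
  node M (fun u => `|a u| `^ p) s <= 2 ->
  \sum_(size s <= k < M) node M (fun u => a u * walsh_node (N k) u) s ^+ 2 <=
  (12 * q) ^+ 2.
Proof.
move=> p1 q1 pq hN sM a2; set n := size s in sM *.
pose b k := node M (fun u => a u * walsh_node (N k) u) s.
set S2 := \sum_(n <= k < M) _.
have bS k : (n <= k < M)%N -> b k ^+ 2 <= S2.
  move=> /andP[nk kM]; rewrite /S2 (@big_cat_nat _ _ _ k)//=; last exact: ltnW.
  rewrite (big_ltn kM) addrCA lerDl addr_ge0// sumr_ge0// => i _; exact: sqr_ge0.
have S20 : 0 <= S2 by rewrite sumr_ge0// => k _; exact: sqr_ge0.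
have q0 : 0 < q by lra.
have p0 : 0 < p by lra.
move: S20; rewrite le_eqVlt => /predU1P[<-|S2gt]; first exact: sqr_ge0.
pose S := Num.sqrt S2; have S0 : 0 < S by rewrite sqrtr_gt0.
have SS : S ^+ 2 = S2 by rewrite sqr_sqrtr// ltW.
(* Extending by 0 makes the known part of the exponential moment trivial at [s]. *)
pose c k := if (n <= k < M)%N then b k / (2 * S) else 0.
have c1 k : `|c k| <= 1 / 2.
  rewrite /c; case: ifPn => [/bS|_]; last by rewrite normr0.
  rewrite -SS => b2; have bk : `|b k| <= S.
    by rewrite -(@ler_pXn2r _ 2)// ?nnegrE ?real_normK ?num_real// ltW.
  rewrite normrM normfV (gtr0_norm (_ : 0 < 2 * S)) ?mulr_gt0//.
  by rewrite ler_pdivrMr ?mulr_gt0//; lra.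
pose v u := \sum_(k < M) c k * walsh_node (N k) u.
have sumc (F : nat -> R) : \sum_(k < M) c k * F k = \sum_(n <= k < M) b k / (2 * S) * F k.
  rewrite -(big_mkord xpredT (fun k => c k * F k)) (big_cat_nat (n := n))//=.
  rewrite big_nat big1 ?add0r => [|k /andP[_ kn]]; last first.
    by rewrite /c leqNgt kn/= mul0r.
  by rewrite big_nat [RHS]big_nat; apply: eq_bigr => k kn; rewrite /c kn.
have avE : node M (fun u => a u * v u) s = S / 2.
  transitivity (\sum_(k < M) c k * b k).
    rewrite /b /node; under [RHS]eq_bigr do rewrite -stopped_meanZ.
    rewrite -(stopped_mean_sum predT _ _
      (fun k u => c k * (a u * walsh_node (N k) u))).
    congr stopped_mean; apply/funext => u; rewrite mulr_sumr.
    by apply: eq_bigr => k _; rewrite mulrCA.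
  rewrite sumc; under eq_bigr do rewrite mulrAC -expr2.
  by rewrite -mulr_suml -/S2 -SS; field; rewrite gt_eqF.
have c2 (d : nat -> R) : (forall k, d k ^+ 2 = c k ^+ 2) ->
    \sum_(n <= k < M) 2 * d k ^+ 2 = 1 / 2.
  move=> dc; under eq_bigr do rewrite dc.
  rewrite -mulr_sumr.
  transitivity (2 * \sum_(k < M) c k * c k).
    congr (_ * _); rewrite sumc big_nat [RHS]big_nat.
    by apply: eq_bigr => k kn; rewrite /c kn expr2.
  rewrite sumc.
  have -> : \sum_(n <= k < M) b k / (2 * S) * c k =
            \sum_(n <= k < M) b k ^+ 2 / (4 * S2).
    rewrite big_nat [RHS]big_nat; apply: eq_bigr => k kn.
    by rewrite /c kn -SS; field; rewrite gt_eqF.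
  by rewrite -mulr_suml -/S2; field; rewrite gt_eqF.
have expv (d : nat -> R) : (forall k, `|d k| = `|c k|) ->
    node M (fun u => expR (\sum_(k < M) d k * walsh_node (N k) u)) s <= 2.
  move=> dc; have d1 k : `|d k| <= 1 / 2 by rewrite dc.
  apply: (le_trans (walsh_exp_mean hN d1 (subnKC sM))).
  rewrite c2; last first.
    by move=> k; rewrite -[LHS]real_normK ?num_real// dc real_normK ?num_real.
  rewrite big1 ?add0r => [|i _]; last first.
    suff -> : d i = 0 by rewrite mul0r.
    by apply/eqP; rewrite -normr_eq0 dc /c leqNgt ltn_ord/= normr0.
  by apply: le_trans (expR_le_quadratic _) _; [rewrite ger0_norm; lra|lra].
have pt u : a u * v u <= q * (`|a u| `^ p + (expR (v u) + expR (- v u))).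
  apply: le_trans (ler_norm _) _; rewrite normrM.
  have -> : `|a u| * `|v u| = q * (`|a u| * (`|v u| / q)).
    by field; rewrite gt_eqF.
  rewrite ler_pM2l//.
  apply: (le_trans (conjugate_powR (normr_ge0 _) _ p0 q0 pq)).
    by rewrite divr_ge0// ltW.
  have e1 : `|a u| `^ p / p <= `|a u| `^ p.
    by rewrite ler_pdivrMr// ler_peMr ?powR_ge0// ltW.
  have e2 : (`|v u| / q) `^ q / q <= expR `|v u|.
    rewrite ler_pdivrMr//; apply: (@le_trans _ _ (expR `|v u|)); last first.
      by rewrite ler_peMr ?expR_ge0// ltW.
    have -> : expR `|v u| = expR (`|v u| / q) `^ q.
      by rewrite -expRM divfK// gt_eqF.
    rewrite ge0_ler_powR ?nnegrE ?expR_ge0 ?divr_ge0//; try exact: ltW.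
    by have := expR_ge1Dx (`|v u| / q); lra.
  have e3 : expR `|v u| <= expR (v u) + expR (- v u).
    by case: (ger0P (v u)) => _; rewrite ?lerDl ?lerDr expR_ge0.
  lra.
have vN u : - v u = \sum_(k < M) (- c k) * walsh_node (N k) u.
  by rewrite /v -sumrN; apply: eq_bigr => k _; rewrite mulNr.
have : S / 2 <= q * (2 + (2 + 2)).
  rewrite -avE; apply: (le_trans (node_mono (M := M) sM (fun u _ => pt u))).
  rewrite /node stopped_meanZ ler_pM2l// !stopped_meanD lerD//.
  apply: lerD; first exact: expv.
  rewrite (funext (fun u => congr1 expR (vN u))).
  by apply: (expv (fun k => - c k)) => k; rewrite normrN.
rewrite -SS => S12; rewrite ler_sqr ?nnegrE; nra.
Qed.
(** * Walsh partial sums as martingale transforms *)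

Lemma mean_mulr {R : realType} n (a g : seq bool -> R) s :
  (forall u b, (size s <= size u)%N -> g (rcons u b) = g u) ->
  mean n (fun u => a u * g u) s = mean n a s * g s.
Proof.
elim: n s => //= n IH s gs; rewrite !IH ?gs//; first by field.
all: by move=> u b; rewrite size_rcons => /ltnW; exact: gs.
Qed.

Lemma node_mulr {R : realType} M (a g : seq bool -> R) s :
  (forall u b, (size s <= size u)%N -> g (rcons u b) = g u) ->
  node M (fun u => a u * g u) s = node M a s * g s.
Proof. exact: mean_mulr. Qed.

Lemma node_mul_walsh_small {R : realType} M n (a : seq bool -> R) s :
  (n < 2 ^ size s)%N ->
  node M (fun u => a u * walsh_node n u) s = node M a s * walsh_node n s.
Proof.
move=> ns; apply: node_mulr => u b su; apply: walsh_node_rcons_small.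
by rewrite (leq_trans ns)// leq_exp2l.
Qed.

(** At depth [k] the mean of [a] times a Walsh function of the block
[2^k <= n < 2^{k+1}] is, up to sign, the increment of the martingale of [a]; it
does not depend on the index inside the block. *)
Lemma node_mul_walsh_lead {R : realType} M n (a : seq bool -> R) s :
  (size s < M)%N -> (2 ^ size s <= n < 2 ^ (size s).+1)%N ->
  node M (fun u => a u * walsh_node n u) s =
  walsh_node n s * ((node M a (rcons s false) - node M a (rcons s true)) / 2).
Proof.
move=> sM ns; rewrite (node_martingale _ sM).
have ns' : (n < 2 ^ (size s).+1)%N by case/andP: ns.
rewrite !node_mul_walsh_small ?size_rcons// !walsh_node_rcons_lead//.
by rewrite expr0 expr1; field.
Qed.

Definition rademacher {R : realType} (k : nat) (s : seq bool) : R :=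
  (-1) ^+ nth false s k.

Lemma rademacher_rcons {R : realType} (s : seq bool) b :
  rademacher (size s) (rcons s b) = (-1) ^+ b :> R.
Proof. by rewrite /rademacher nth_rcons ltnn eqxx. Qed.

Lemma bit_add k j n : (n < 2 ^ k)%N -> bit j (2 ^ k + n) = ((j == k) + bit j n)%N.
Proof.
move=> nk; have [jk|kj|->] := ltngtP j k.
- rewrite /bit add0n -(subnK (ltnW jk)) expnD divnMDl ?expn_gt0//.
  by rewrite -(subnSK jk) expnS mulnC modnMDl.
- have lt : (2 ^ k + n < 2 ^ j)%N.
    apply: (@leq_trans (2 ^ k.+1)); last by rewrite leq_exp2l.
    by rewrite expnS mul2n -addnn ltn_add2l.
  by rewrite !bit_small// (leq_ltn_trans _ lt)// leq_addl.
- rewrite (bit_small nk) bit_lead// leq_addr/=.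
  by rewrite expnS mul2n -addnn ltn_add2l.
Qed.

Lemma walsh_node0 {R : realType} s : walsh_node 0 s = 1 :> R.
Proof.
by rewrite /walsh_node big1// => k _; rewrite bit_small ?expn_gt0// expr0.
Qed.

Lemma walsh_node_add {R : realType} k n s :
  (n < 2 ^ k)%N -> (k < size s)%N ->
  walsh_node (2 ^ k + n) s = rademacher k s * walsh_node n s :> R.
Proof.
move=> nk ks; rewrite /walsh_node.
under eq_bigr do rewrite bit_add// exprD.
rewrite big_split/=; congr (_ * _).
rewrite (bigD1 (Ordinal ks))//= eqxx expr1 big1 ?mulr1// => i.
by rewrite -val_eqE/= => /negPf ->; rewrite expr0.
Qed.

Lemma walsh_node_take {R : realType} k n s : (n < 2 ^ k)%N -> (k <= size s)%N ->
  walsh_node n s = walsh_node n (take k s) :> R.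
Proof.
move=> nk; elim/last_ind: s => // s b IH; rewrite size_rcons leq_eqVlt.
case/predU1P => [ks|]; first by rewrite take_oversize// size_rcons ks.
rewrite ltnS => ks; rewrite take_rcons// walsh_node_rcons_small ?IH//.
by rewrite (leq_trans nk)// leq_exp2l.
Qed.

Definition walsh_partial_sum {R : realType} M N (a : seq bool -> R) s : R :=
  \sum_(n < N) node M (fun u => a u * walsh_node n u) [::] * walsh_node n s.

(** The functions W_{2^k + n} with [n < N] are the products of the Rademacher
function of index [k] with the W_n: the second half of the sum is a modulated
partial sum of a modulated function. *)
Lemma walsh_partial_sum_add {R : realType} M k N (a : seq bool -> R) s :
  size s = M -> (k < M)%N -> (N <= 2 ^ k)%N ->
  walsh_partial_sum M (2 ^ k + N) a s = walsh_partial_sum M (2 ^ k) a s +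
    rademacher k s * walsh_partial_sum M N (fun u => a u * rademacher k u) s.
Proof.
move=> sM kM Nk; rewrite /walsh_partial_sum big_split_ord/=; congr (_ + _).
rewrite mulr_sumr; apply: eq_bigr => n _.
have nk : (n < 2 ^ k)%N by rewrite (leq_trans _ Nk).
rewrite walsh_node_add ?sM// mulrCA; congr (_ * _); congr (_ * _).
by apply: node_eq => // u uM; rewrite walsh_node_add ?uM// mulrA.
Qed.

Lemma walsh_partial_sum_pow2 {R : realType} M k (a : seq bool -> R) s :
  size s = M -> (k <= M)%N ->
  walsh_partial_sum M (2 ^ k) a s = node M a (take k s).
Proof.
move=> sM; elim: k a => [|k IH] a kM.
  rewrite /walsh_partial_sum big_ord1 walsh_node0 mulr1 take0.
  by apply: node_eq => // u _; rewrite walsh_node0 mulr1.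
rewrite expnS mul2n -addnn walsh_partial_sum_add// !IH ?(ltnW kM)//.
have kt : size (take k s) = k by rewrite size_takel// sM ltnW.
rewrite (take_nth false) ?sM//.
have -> : node M (fun u => a u * rademacher k u) (take k s) =
    (node M a (rcons (take k s) false) - node M a (rcons (take k s) true)) / 2.
  have rad b : rademacher k (rcons (take k s) b) = (-1) ^+ b :> R.
    by rewrite -{1}kt rademacher_rcons.
  have radS c u b : (size (rcons (take k s) c) <= size u)%N ->
      rademacher k (rcons u b) = rademacher k u :> R.
    by rewrite size_rcons kt => ku; rewrite /rademacher nth_rcons ku.
  rewrite (@node_martingale _ M _ (take k s)) ?kt//.
  rewrite (node_mulr _ _ (radS false)) (node_mulr _ _ (radS true)) !rad.
  by rewrite expr0 expr1; field.
rewrite (@node_martingale _ M a (take k s)) ?kt//.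
by rewrite /rademacher; case: nth; rewrite ?expr0 ?expr1; field.
Qed.

(** Induction on the leading binary digit. The leading term W_N D_m (a W_N) is E_m a,
and the lower digits come from the induction hypothesis for the modulated
function. *)
Lemma walsh_partial_sumE {R : realType} M m N (a : seq bool -> R) s :
  size s = M -> (m <= M)%N -> (N < 2 ^ m)%N ->
  walsh_partial_sum M N a s = walsh_node N s *
    \sum_(i < M) (bit i N)%:R *
      (node M (fun u => a u * walsh_node N u) (take i.+1 s) -
       node M (fun u => a u * walsh_node N u) (take i s)).
Proof.
move=> sM; elim: m N a => [|m IH] N a mM.
  rewrite expn0 ltnS leqn0 => /eqP ->.
  rewrite /walsh_partial_sum big_ord0 big1 ?mulr0// => i _.
  by rewrite bit_small ?expn_gt0// mul0r.
move=> Nm; have [/IH->//|mN] := ltnP N (2 ^ m); first exact: ltnW.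
have [N' N'm NE] : exists2 N', (N' < 2 ^ m)%N & N = (2 ^ m + N')%N.
  exists (N - 2 ^ m)%N; last by rewrite subnKC.
  by rewrite ltn_subLR// addnn -mul2n -expnS.
pose h u := a u * walsh_node N u.
have hE u : size u = M -> a u * rademacher m u * walsh_node N' u = h u.
  by move=> uM; rewrite /h NE walsh_node_add ?uM// mulrA.
rewrite [in LHS]NE walsh_partial_sum_add//; last exact: ltnW.
rewrite walsh_partial_sum_pow2//; last exact: ltnW.
rewrite IH//; last exact: ltnW.
pose D i := node M h (take i.+1 s) - node M h (take i s).
have -> : \sum_(i < M) (bit i N)%:R * D i =
    D m + \sum_(i < M) (bit i N')%:R * D i.
  rewrite NE; under eq_bigr do rewrite bit_add// natrD mulrDl.
  rewrite big_split/=; congr (_ + _).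
  rewrite (bigD1 (Ordinal mM))//= eqxx mul1r big1 ?addr0// => i.
  by rewrite -val_eqE/= => /negPf ->; rewrite mul0r.
rewrite mulrDr; congr (_ + _); last first.
  rewrite NE walsh_node_add ?sM// -mulrA; congr (_ * (_ * _)).
  apply: eq_bigr => i _; congr (_ * (_ - _)); apply: node_eq => //.
  - by rewrite size_take_min sM geq_minr.
  - by rewrite size_take_min sM geq_minr.
have mt : size (take m s) = m by rewrite size_takel// sM ltnW.
rewrite (@walsh_node_take _ m.+1)// ?sM// (take_nth false) ?sM//.
set u := take m s; set b := nth false s m.
have Nu : (2 ^ size u <= N < 2 ^ (size u).+1)%N by rewrite mt mN Nm.
rewrite /D (take_nth false) ?sM// -/u -/b.
rewrite node_mul_walsh_small ?size_rcons ?mt//.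
rewrite (node_mul_walsh_lead _ _ Nu) ?mt// walsh_node_rcons_lead//.
rewrite (@node_martingale _ M a u) ?mt//.
have := walsh_node_sq (R := R) N u; set w := walsh_node N u => w1.
transitivity (w ^+ 2 * ((node M a (rcons u false) + node M a (rcons u true)) / 2)).
  by rewrite w1 mul1r.
by case: (b); rewrite ?expr0 ?expr1; field.
Qed.

Lemma bit_odd k n : bit k n = odd (n %/ 2 ^ k).
Proof. by rewrite /bit modn2. Qed.

(** The leading digit of [N] is separated because E_k is controlled by the stopping,
whereas the transform needs the exponential estimate. Keeping only [i < k] makes
the energy of the transform stop at time [k]. *)
Lemma walsh_partial_sum_block {R : realType} M k N (a : seq bool -> R) s :
  size s = M -> (k < M)%N -> (2 ^ k <= N < 2 ^ k.+1)%N ->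
  walsh_partial_sum M N a s = node M a (take k s) +
    walsh_node N s * transform (fun i => (i < k)%N && odd (N %/ 2 ^ i))
      (node M (fun u => a u * walsh_node N u)) s.
Proof.
move=> sM kM /andP[kN Nk].
have [N' N'k NE] : exists2 N', (N' < 2 ^ k)%N & N = (2 ^ k + N')%N.
  exists (N - 2 ^ k)%N; last by rewrite subnKC.
  by rewrite ltn_subLR// addnn -mul2n -expnS.
rewrite [in LHS]NE walsh_partial_sum_add//; last exact: ltnW.
rewrite walsh_partial_sum_pow2//; last exact: ltnW.
congr (_ + _); rewrite (walsh_partial_sumE _ sM (ltnW kM) N'k).
rewrite [in RHS]NE walsh_node_add ?sM// -mulrA; congr (_ * (_ * _)).
rewrite /transform sM; apply: eq_bigr => i _; congr (_ * (_ - _)).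
- case: ltnP => ik /=; last by rewrite bit_small// (leq_trans N'k)// leq_exp2l.
  by rewrite -bit_odd bit_add// ltn_eqF.
- apply: node_eq => [|u uM]; first by rewrite size_take_min sM geq_minr.
  by rewrite walsh_node_add ?uM// mulrA.
- apply: node_eq => [|u uM]; first by rewrite size_take_min sM geq_minr.
  by rewrite walsh_node_add ?uM// mulrA.
Qed.
(** * The maximal inequality on the tree *)

(** The graph of x^p / p lies above its tangent at [c]. Taking the mean over [x]
gives Jensen's inequality, both on the tree and on a cell. *)
Lemma young_tangent {R : realType} (p c x : R) : 1 < p -> 0 <= c -> 0 <= x ->
  c `^ (p - 1) * x <= x `^ p / p + c `^ p / conj_exponent p.
Proof.
move=> p1 c0 x0; have p0 : 0 < p by lra.
have q0 : 0 < conj_exponent p by rewrite divr_gt0//; lra.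
rewrite mulrC.
have -> : c `^ p = (c `^ (p - 1)) `^ conj_exponent p.
  by rewrite -powRrM /conj_exponent mulrC divfK// gt_eqF//; lra.
apply: conjugate_powR => //; first exact: powR_ge0.
by rewrite /conj_exponent; field; rewrite !gt_eqF//; lra.
Qed.

Lemma powR_jensen_of_tangent {R : realType} (p c mp : R) : 1 < p -> 0 <= c ->
  c `^ (p - 1) * c <= mp / p + c `^ p / conj_exponent p -> c `^ p <= mp.
Proof.
move=> p1 c0; rewrite mulrC mulr_powRB1//; last by lra.
move=> h; have p0 : 0 < p by lra.
suff : c `^ p / p <= mp / p by rewrite ler_pM2r ?invr_gt0.
have -> : c `^ p / p = c `^ p - c `^ p / conj_exponent p.
  by rewrite /conj_exponent; field; rewrite !gt_eqF//; lra.
lra.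
Qed.

Lemma node_norm_powR {R : realType} M (phi : seq bool -> R) p s :
  1 < p -> (size s <= M)%N ->
  `|node M phi s| `^ p <= node M (fun u => `|phi u| `^ p) s.
Proof.
move=> p1 sM; set c := node M (fun u => `|phi u|) s.
have le : `|node M phi s| <= c.
  rewrite ler_norml; apply/andP; split.
    rewrite /c /node -stopped_meanN; apply: node_mono => // u _.
    by rewrite lerNl -normrN ler_norm.
  by apply: node_mono => // u _; exact: ler_norm.
have c0 : 0 <= c by exact: le_trans le.
apply: (@le_trans _ _ (c `^ p)).
  by rewrite ge0_ler_powR ?nnegrE//; lra.
apply: powR_jensen_of_tangent => //.
rewrite [in leLHS]/c /node -stopped_meanZ.
apply: (@le_trans _ _ (mean (M - size s)
    (fun u => p^-1 * `|phi u| `^ p + c `^ p / conj_exponent p) s)).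
  apply: node_mono => // u _; rewrite (mulrC p^-1); exact: young_tangent.
by rewrite stopped_meanD mean_cst stopped_meanZ mulrC.
Qed.

(** The paths that halt early count as if the event always occurred on them. *)
Lemma mean_le_stopped {R : realType} (live : pred (seq bool)) n
    (f : seq bool -> R) s :
  (forall u, f u <= 1) ->
  mean n f s <= stopped_mean live n (fun u => if live u then f u else 1) s.
Proof.
move=> f1; elim: n s => [|n IH] s /=; first by case: ifP.
case: ifPn => ls; first by rewrite ler_pM2r ?invr_gt0// lerD.
have m1 u : mean n f u <= 1.
  rewrite -(mean_cst n 1 u).
  by apply: (stopped_mean_mono (M := (size u + n)%N)).
by rewrite (negPf ls) ler_pdivrMr// mul1r lerD// m1.
Qed.

Lemma conj_exponent_ge2 {R : realType} (p : R) : 1 < p -> p <= 2 ->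
  2 <= conj_exponent p.
Proof. by move=> p1 p2; rewrite /conj_exponent ler_pdivlMr; lra. Qed.

Lemma log1_ge1 {R : realType} (t : R) : 0 <= t -> 1 <= log1 t.
Proof.
move=> t0; rewrite /log1 -[leLHS](expRK 1) ler_ln ?posrE ?lerDl ?expR_gt0//.
by rewrite ltr_wpDr ?expR_gt0.
Qed.

(** The logarithm enters here: exp (2 log_1 q) = (e + q)^2 dominates q^2. *)
Lemma cosh_excess_log1 {R : realType} (q x : R) : 0 <= q ->
  16 * log1 q <= `|x| -> q ^+ 2 / 2 <= cosh_excess x.
Proof.
move=> q0 xl.
have e2 : (expR 1 + q) ^+ 2 <= expR (`|x| / 8).
  have eq0 : 0 < expR 1 + q by rewrite ltr_wpDr ?expR_gt0.
  have -> : (expR 1 + q) ^+ 2 = expR (log1 q * 2%:R).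
    by rewrite expRM_natr /log1 lnK ?posrE.
  by rewrite ler_expR; lra.
have e1 : 2 <= expR 1 :> R by have := expR_ge1Dx (1 : R); lra.
have : expR (`|x| / 8) <= expR (x / 8) + expR (- (x / 8)).
  by case: (ger0P x) => _; rewrite ?mulNr ?lerDl ?lerDr expR_ge0.
rewrite /cosh_excess; nra.
Qed.

(** The level alpha of the stopping rule is normalized to 1, and the other constants
are chosen accordingly. [H k] is the martingale of the modulated function divided
by 2, so that it is bounded by 1 at the reached nodes. *)
Lemma dyadic_lacunary_maximal {R : realType} M p (a : seq bool -> R)
    (N : nat -> nat) :
  1 < p -> p <= 2 -> (forall k, 2 ^ k <= N k < 2 ^ k.+1)%N ->
  mean M (fun s => [exists k : 'I_M, 64 * log1 (conj_exponent p) <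
            `|walsh_partial_sum M (N k) a s|]%:R) [::] <=
  75 * mean M (fun s => `|a s| `^ p) [::].
Proof.
move=> p1 p2 hN; set q := conj_exponent p.
have q2 : 2 <= q by exact: conj_exponent_ge2.
have l1 : 1 <= log1 q by apply: log1_ge1; lra.
set f := (X in mean _ X _ <= _).
have f1 u : f u <= 1 by rewrite /f; case: [exists _, _].
pose Q := node M (fun s => `|a s| `^ p).
have mQ : martingale M Q by exact: node_martingale.
have Q0 s : (size s <= M)%N -> 0 <= Q s.
  move=> sM; rewrite -(mean_cst (M - size s) 0 s).
  by apply: node_mono => // u _; exact: powR_ge0.
have -> : mean M (fun s => `|a s| `^ p) [::] = Q [::] by rewrite /Q /node subn0.
pose live s := Q s <= 1.
(* If the root itself is stopped, there is nothing to prove; otherwise every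
   reached node is the root or the child of a live node. *)
have [Qbig|Qle] := ltP 1 (Q [::]).
  apply: (@le_trans _ _ 1); last lra.
  rewrite -(mean_cst M 1 [::]).
  by apply: (stopped_mean_mono (M := M)).
pose T F := stopped_mean live M F [::] : R.
(* A child of a live node has at most twice the mean of its parent. *)
have Q2 s : reached live s -> (size s <= M)%N -> Q s <= 2.
  case/lastP: s => [|u b]; first by lra.
  move=> /(_ (size u)); rewrite size_rcons => /(_ (leqnn _)).
  rewrite take_rcons_size /live => Qu uM.
  have := mQ u uM.
  have := Q0 (rcons u false); have := Q0 (rcons u true).
  by rewrite !size_rcons => /(_ uM) ? /(_ uM) ?; case: b; lra.
pose h k u := a u * walsh_node (N k) u.
pose A := node M a; have mA : martingale M A by exact: node_martingale.
have h_le k s : (size s <= M)%N -> `|node M (h k) s| `^ p <= Q s.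
  move=> sM; apply: le_trans (node_norm_powR _ p1 sM) _.
  by apply: node_mono => // u _; rewrite normrM walsh_node_norm mulr1.
have A_le s : (size s <= M)%N -> `|A s| `^ p <= Q s by exact: node_norm_powR.
have root x y : 1 <= y -> x `^ p <= y -> x <= y.
  move=> y1 xy; rewrite leNgt; apply/negP => yx.
  have : x <= x `^ p by apply: le1r_powR; lra.
  lra.
have h2 k s : reached live s -> (size s <= M)%N -> `|node M (h k) s| <= 2.
  move=> rs sM; apply: root; first lra.
  exact: le_trans (h_le _ _ sM) (Q2 _ rs sM).
pose H k s := node M (h k) s / 2.
have mH k : martingale M (H k).
  by move=> s sM; rewrite /H (@node_martingale _ M (h k) s sM); field.
have H1 k s : reached live s -> (size s <= M)%N -> `|H k s| <= 1.
  by move=> rs sM; rewrite /H normrM normfV normr_nat ler_pdivrMr// mul1r h2.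
pose e k i := (i < k)%N && odd (N k %/ 2 ^ i).
pose F k := transform (e k) (H k).
have exc k : T (fun s => cosh_excess (F k s)) <= T (fun s => H k (take k s) ^+ 2).
  apply: (le_trans (transform_exp_le (e k) (mH k) (H1 k))).
  by apply: quadratic_mean_le => // i _ /andP[].
have energy : \sum_(k < M) T (fun s => H k (take k s) ^+ 2) <=
    (1 + 36 * q ^+ 2) * Q [::].
  rewrite /T -(stopped_mean_sum live M M (fun k s => H k (take k s) ^+ 2)).
  have -> : (1 + 36 * q ^+ 2) * Q [::] =
      T (fun s => 4^-1 * (4 * Q s) + 36 * q ^+ 2 * Q s).
    rewrite /T stopped_meanD !stopped_meanZ (stopped_mean_martingale _ mQ)//.
    by field.
  (* Where the path halts at depth n, the k < n give the increments of [A], and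
     the k >= n the lacunary coefficients in the interval of that node. The
     latter occur only at nodes that are not live, where 1 < Q s. *)
  apply: (@le_trans _ _ (T (fun s => 4^-1 * quadratic predT A s +
      36 * q ^+ 2 * Q s))).
    apply: (stopped_mean_mono (M := M)) => // s rs sM lsM.
    rewrite -(big_mkord xpredT (fun k => H k (take k s) ^+ 2)).
    rewrite (big_cat_nat (n := size s))//= big_mkord; apply: lerD.
      rewrite mulr_sumr; apply: ler_sum => k _.
      have kt : size (take k s) = k by rewrite size_takel// ltnW.
      have kM : (k < M)%N by rewrite (leq_trans _ sM).
      rewrite /H /h mulr1n mul1r (take_nth false)//.
      rewrite node_mul_walsh_lead ?kt// !exprMn walsh_node_sq.
      have := mA (take k s); rewrite kt => /(_ kM).
      rewrite /A; case: (nth _ _ _) => ->; lra.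
    case: (eqVneq (size s) M) => [->|sneq].
      by rewrite big_geq//; apply: mulr_ge0; [rewrite mulr_ge0 ?sqr_ge0|exact: Q0].
    have Qs : 1 < Q s.
      by rewrite ltNge; apply/negP => /lsM/eqP; rewrite (negPf sneq).
    have q1 : 1 < q by lra.
    have pq : p^-1 + q^-1 = 1.
      by rewrite /q /conj_exponent; field; rewrite !gt_eqF//; lra.
    have le := lacunary_walsh_coeff_le p1 q1 pq hN sM (Q2 _ rs sM).
    have q4 : 0 <= 4^-1 :> R by rewrite invr_ge0.
    have {}le := ler_wpM2l q4 le.
    rewrite mulr_sumr in le.
    apply: (@le_trans _ _ (4^-1 * (12 * q) ^+ 2)); last first.
      have Qs1 : 0 <= Q s - 1 by lra.
      by have := mulr_ge0 (sqr_ge0 q) Qs1; lra.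
    apply: le_trans le; rewrite big_nat [leRHS]big_nat.
    apply: ler_sum => k /andP[sk _]; rewrite take_oversize// /H /h.
    by set x := node _ _ _; lra.
  rewrite /T !stopped_meanD lerD2r !stopped_meanZ ler_pM2l//.
  apply: (le_trans (quadratic_mean_le (k := M) (e := predT) live mA _)) => //.
  rewrite -stopped_meanZ; apply: (stopped_mean_mono (M := M)) => // s rs sM lsM.
  rewrite take_oversize//.
  have As := A_le s sM; rewrite -[X in X <= _]real_normK ?num_real//.
  have An := normr_ge0 (A s).
  have [ls|ls] := leP (Q s) 1; last first.
    have A2 : `|A s| <= 2 by apply: root; [lra|exact: le_trans As (Q2 _ rs sM)].
    nra.
  have A1 : `|A s| <= 1 by apply: root => //; lra.
  apply: (@le_trans _ _ (Q s)); last by have := Q0 s sM; lra.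
  apply: le_trans As; move: An; rewrite le_eqVlt => /predU1P[<-|An].
    by rewrite expr0n/= powR_ge0.
  rewrite -powR_mulrn; last exact: ltW.
  by apply: ger_powR => //; rewrite An A1.
apply: (le_trans (mean_le_stopped live M [::] f1)).
apply: (@le_trans _ _ (T (fun s => Q s + 2 / q ^+ 2 *
    \sum_(k < M) cosh_excess (F k s)))).
  apply: (stopped_mean_mono (M := M)) => // s rs sM lsM.
  have q20 : 0 < 2 / q ^+ 2 by rewrite divr_gt0// exprn_gt0//; lra.
  have sum0 : 0 <= \sum_(k < M) cosh_excess (F k s).
    by apply: sumr_ge0 => k _; exact: cosh_excess_ge0.
  case: ifPn => [ls|]; last first.
    by rewrite /live -ltNge => Qs; have := mulr_ge0 (ltW q20) sum0; lra.
  have {}sM : size s = M by exact: lsM.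
  rewrite ler_wpDl ?Q0 ?sM// /f; case: existsP => [[k big]|_]; last first.
    by apply: mulr_ge0 => //; exact: ltW.
  rewrite mulr1n -ler_pdivrMl// mulr1 invf_div.
  rewrite (bigD1 k)//= ler_wpDr//.
    by apply: sumr_ge0 => i _; exact: cosh_excess_ge0.
  apply: cosh_excess_log1; first by lra.
  move: big; rewrite (walsh_partial_sum_block _ sM (ltn_ord k) (hN k)).
  have tk : live (take k s) by apply: rs; rewrite sM.
  have tkM : (size (take k s) <= M)%N by rewrite size_takel ?sM// ltnW.
  have A1 : `|A (take k s)| <= 1.
    by apply: root => //; exact: le_trans (A_le _ tkM) tk.
  rewrite -/(h k) -/(e k) -/A.
  have -> : transform (e k) (node M (h k)) s = 2 * F k s.
    rewrite /F /transform mulr_sumr; apply: eq_bigr => i _.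
    by rewrite /H; field.
  move=> big; have := ler_normD (A (take k s)) (walsh_node (N k) s * (2 * F k s)).
  rewrite normrM walsh_node_norm mul1r normrM normr_nat; lra.
rewrite /T stopped_meanD stopped_meanZ (stopped_mean_martingale _ mQ)//.
rewrite (stopped_mean_sum live M M (fun k s => cosh_excess (F k s))).
have : \sum_(k < M) T (fun s => cosh_excess (F k s)) <= (1 + 36 * q ^+ 2) * Q [::].
  by apply: le_trans energy; apply: ler_sum => k _; exact: exc.
have q20 : 0 < 2 / q ^+ 2 by rewrite divr_gt0// exprn_gt0//; lra.
rewrite -(ler_pM2l q20) => /(lerD (lexx (Q [::]))) /le_trans; apply.
have -> : Q [::] + 2 / q ^+ 2 * ((1 + 36 * q ^+ 2) * Q [::]) =
    (73 + 2 / q ^+ 2) * Q [::] by field; rewrite gt_eqF//; lra.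
rewrite ler_wpM2r ?Q0//.
have : 2 / q ^+ 2 <= 1 by rewrite ler_pdivrMr ?exprn_gt0//; nra.
lra.
Qed.
Lemma walsh_partial_sumZ {R : realType} M N c (a : seq bool -> R) s :
  walsh_partial_sum M N (fun u => c * a u) s = c * walsh_partial_sum M N a s.
Proof.
rewrite /walsh_partial_sum mulr_sumr; apply: eq_bigr => n _.
rewrite mulrA /node -stopped_meanZ; congr (_ * _); congr stopped_mean.
by apply/funext => u; rewrite mulrA.
Qed.

Lemma dyadic_lacunary_weak_type {R : realType} M p lambda (a : seq bool -> R)
    (N : nat -> nat) :
  1 < p -> p <= 2 -> 0 < lambda -> (forall k, 2 ^ k <= N k < 2 ^ k.+1)%N ->
  mean M (fun s => [exists k : 'I_M,
      lambda < `|walsh_partial_sum M (N k) a s|]%:R) [::] <=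
  75 * (64 * log1 (conj_exponent p) / lambda) `^ p *
    mean M (fun s => `|a s| `^ p) [::].
Proof.
move=> p1 p2 l0 hN; set A := 64 * _.
have A0 : 0 < A.
  rewrite mulr_gt0//; apply: (@lt_le_trans _ _ 1) => //; apply: log1_ge1.
  by have := conj_exponent_ge2 p1 p2; lra.
pose c := A / lambda; have c0 : 0 < c by rewrite divr_gt0.
have := dyadic_lacunary_maximal M (fun u => c * a u) p1 p2 hN.
rewrite -/A; have -> : mean M (fun s => `|c * a s| `^ p) [::] =
    c `^ p * mean M (fun s => `|a s| `^ p) [::].
  rewrite -stopped_meanZ; congr stopped_mean; apply/funext => s.
  by rewrite normrM (gtr0_norm c0) powRM// ltW.
rewrite mulrA.
congr (_ <= _); congr stopped_mean; apply/funext => s; congr (_%:R).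
congr nat_of_bool; apply: eq_existsb => k.
rewrite walsh_partial_sumZ normrM (gtr0_norm c0) /c -ltr_pdivrMl//.
by rewrite invf_div divfK// gt_eqF.
Qed.

Import numFieldNormedType.Exports.
Local Open Scope classical_set_scope.

(** * Dyadic cells of the torus *)

Definition dyadic_left {R : realType} (s : seq bool) : R :=
  \sum_(i < size s) (nth false s i)%:R / 2 ^+ i.+1.

Lemma dyadic_left_rcons {R : realType} s b :
  dyadic_left (rcons s b) = dyadic_left s + b%:R / 2 ^+ (size s).+1 :> R.
Proof.
rewrite /dyadic_left size_rcons big_ord_recr/= nth_rcons ltnn eqxx; congr (_ + _).
by apply: eq_bigr => i _; rewrite nth_rcons ltn_ord.
Qed.

Lemma dyadic_left_nat {R : realType} (s : seq bool) :
  exists m : nat, 2 ^+ size s * dyadic_left s = m%:R :> R.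
Proof.
elim/last_ind: s => [|s b [m IH]].
  by exists 0%N; rewrite /dyadic_left big_ord0 mulr0.
exists (2 * m + b)%N; rewrite size_rcons dyadic_left_rcons mulrDr exprS.
by rewrite -mulrA IH natrD natrM; congr (_ + _); field; rewrite expf_neq0.
Qed.

(** The closed-open interval of the points of the torus whose binary expansion
starts with [s]. *)
Definition cell {R : realType} (s : seq bool) : set R :=
  `[dyadic_left s, dyadic_left s + (2 ^+ size s)^-1[.

Definition open_cell {R : realType} (s : seq bool) : set R :=
  `]dyadic_left s, dyadic_left s + (2 ^+ size s)^-1[.

Lemma exp2_gt0 {R : realType} n : 0 < 2 ^+ n :> R.
Proof. exact: exprn_gt0. Qed.

Lemma half_exp2 {R : realType} n : (2 ^+ n)^-1 = (2 ^+ n.+1)^-1 + (2 ^+ n.+1)^-1 :> R.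
Proof. by rewrite exprS; field; rewrite expf_neq0. Qed.

Lemma cell_nil {R : realType} : cell [::] = torus :> set R.
Proof. by rewrite /cell /dyadic_left big_ord0 expr0 invr1 add0r. Qed.

Lemma cell_split {R : realType} s :
  cell s = cell (rcons s false) `|` cell (rcons s true) :> set R.
Proof.
rewrite /cell !size_rcons !dyadic_left_rcons mul0r addr0 div1r (half_exp2 (size s)).
have h0 : 0 < (2 ^+ (size s).+1)^-1 :> R by rewrite invr_gt0 exp2_gt0.
apply/seteqP; split=> x /=; rewrite !in_itv/=.
  move=> /andP[x1 x2].
  have [xl|xl] := ltP x (dyadic_left s + (2 ^+ (size s).+1)^-1); [left|right].
    by rewrite x1.
  by apply/andP; split; lra.
by case=> /andP[x1 x2]; apply/andP; split; lra.
Qed.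

Lemma cell_disjoint {R : realType} s :
  [disjoint cell (rcons s false) & cell (rcons s true) : set R].
Proof.
rewrite /cell !size_rcons !dyadic_left_rcons mul0r addr0 div1r.
apply/disj_setPS => x /= []; rewrite !in_itv/= => /andP[_ x1] /andP[x2 _].
by have := lt_le_trans x1 x2; rewrite ltxx.
Qed.

Lemma measurable_cell {R : realType} s : measurable (cell s : set R).
Proof. exact: measurable_itv. Qed.

Lemma cell_sub_torus {R : realType} s : (cell s : set R) `<=` torus.
Proof.
rewrite -cell_nil; elim/last_ind: s => // s b; apply: subset_trans.
by rewrite (cell_split s); case: b; [exact: subsetUr|exact: subsetUl].
Qed.

Lemma lebesgue_measure_cell {R : realType} s :
  lebesgue_measure (cell s : set R) = ((2 ^+ size s)^-1)%:E.
Proof.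
rewrite /cell lebesgue_measure_itv/= lte_fin ltrDl invr_gt0 exp2_gt0.
by rewrite -EFinB addrC addKr.
Qed.

Lemma open_cell_rcons_sub {R : realType} s b :
  (open_cell (rcons s b) : set R) `<=` open_cell s.
Proof.
rewrite /open_cell size_rcons dyadic_left_rcons (half_exp2 (size s)).
have h0 : 0 < (2 ^+ (size s).+1)^-1 :> R by rewrite invr_gt0 exp2_gt0.
by move=> x /=; rewrite !in_itv/= => /andP[];
  case: b; rewrite ?mul0r ?mul1r => ? ?; apply/andP; split; lra.
Qed.

Lemma open_cell_take {R : realType} k s :
  (open_cell s : set R) `<=` open_cell (take k s).
Proof.
elim/last_ind: s => // s b IH; have [sk|ks] := leqP (size (rcons s b)) k.
  by rewrite take_oversize.
move: ks; rewrite size_rcons ltnS => ks; rewrite take_rcons//.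
by apply: subset_trans IH; exact: open_cell_rcons_sub.
Qed.

(** After [size s] doublings the point is an integer plus [b / 2] plus a number
strictly between 0 and 1/2. The end points of the cell have to be excluded, as the
sine vanishes there. *)
Lemma sg_sin_dyadic {R : realType} s b (x : R) : open_cell (rcons s b) x ->
  Num.sg (sin (2 ^+ size s * (2 * pi * x))) = (-1) ^+ b.
Proof.
rewrite /open_cell /= in_itv/= dyadic_left_rcons size_rcons => /andP[x1 x2].
have [m mE] := dyadic_left_nat (R := R) s.
pose t := 2 ^+ (size s).+1 * (x - dyadic_left s) - b%:R.
have e0 := exp2_gt0 (R := R) (size s).+1.
have tE : 2 ^+ (size s).+1 * (b%:R / 2 ^+ (size s).+1) = b%:R :> R.
  by rewrite mulrC divfK// gt_eqF.
have t0 : 0 < t.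
  rewrite /t subr_gt0 -[ltLHS]tE ltr_pM2l//; lra.
have t1 : t < 1.
  have -> : 1 = 2 ^+ (size s).+1 * (b%:R / 2 ^+ (size s).+1 +
      (2 ^+ (size s).+1)^-1) - b%:R :> R.
    by rewrite mulrDr tE divff ?gt_eqF//; ring.
  by rewrite /t ltrD2r ltr_pM2l//; lra.
have -> : 2 ^+ size s * (2 * pi * x) =
    pi * t + pi *+ b + (pi *+ 2) *+ m :> R.
  rewrite /t -(mulr_natr (pi *+ 2) m) -(mulr_natr pi b) -mE exprS; ring.
rewrite (periodicn (@sinD2pi R)).
have pt : 0 < sin (pi * t).
  by apply: sin_gt0_pi; rewrite mulr_gt0 ?pi_gt0//= gtr_pMr ?pi_gt0.
rewrite -/t; move: t pt {t0 t1 tE} => t pt; case: b {x1 x2}.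
  by rewrite mulr1n sinDpi sgrN gtr0_sg.
by rewrite mulr0n addr0 gtr0_sg.
Qed.

Lemma walsh_open_cell {R : realType} n s (x : R) : (n < 2 ^ size s)%N ->
  open_cell s x -> walsh n x = walsh_node n s.
Proof.
move=> ns xs.
pose F k : R := Num.sg (sin (2 ^+ k * (2 * pi * x))) ^+ bit k n.
pose m := minn n (size s).
have Fm k : (m <= k)%N -> F k = 1.
  rewrite /m /F geq_min => /orP[/bit_ge ->|sk]; first by rewrite expr0.
  by rewrite bit_small ?expr0// (leq_trans ns)// leq_exp2l.
have cut j : (m <= j)%N -> \prod_(k < j) F k = \prod_(k < m) F k.
  move=> mj; rewrite -(big_mkord xpredT F) (big_cat_nat (n := m))//= big_mkord.
  rewrite [X in _ * X]big_nat [X in _ * X]big1 ?mulr1// => k /andP[mk _].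
  exact: Fm.
rewrite /walsh (cut n) ?geq_minl// -(cut (size s)) ?geq_minr//.
rewrite /walsh_node; apply: eq_bigr => k _; congr (_ ^+ _).
have kt : size (take k s) = k by rewrite size_takel// ltnW.
rewrite -{1}kt; apply: sg_sin_dyadic.
by rewrite -(take_nth false)//; exact: open_cell_take xs.
Qed.

Lemma measurable_sg {R : realType} :
  measurable_fun [set: R] (Num.sg : R -> R).
Proof.
have -> : (Num.sg : R -> R) =
    (fun x => \1_(`]0, +oo[ : set R) x - \1_(`]-oo, 0[ : set R) x).
  apply/funext => x; rewrite !indicE !mem_setE !in_itv/= !andbT.
  by case: sgrP => _; rewrite ?subr0 ?subrr ?sub0r.
by apply: measurable_funB; apply: measurable_indic.
Qed.

Lemma measurable_walsh {R : realType} n : measurable_fun [set: R] (walsh n : R -> R).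
Proof.
rewrite /walsh; apply: measurable_prod => k _; apply: measurable_funX.
apply: (measurableT_comp measurable_sg).
apply: continuous_measurable_fun => x.
apply: (@continuous_comp _ _ _ (fun x : R => 2 ^+ k * (2 * pi * x)) sin).
  by apply: cvgMr; apply: cvgMr; exact: cvg_id.
exact: continuous_sin.
Qed.

Lemma walsh_norm_le1 {R : realType} n (x : R) : `|walsh n x| <= 1.
Proof.
rewrite /walsh normr_prod; apply: prodr_ile1 => k _.
by rewrite normr_ge0/= normrX exprn_ile1// normr_sg lern1 leq_b1.
Qed.
Lemma measurable_torus {R : realType} : measurable (torus : set R).
Proof. exact: measurable_itv. Qed.

(** * Averages over the cells *)

Definition cell_average {R : realType} (f : R -> R) (s : seq bool) : R :=
  2 ^+ size s * \int[lebesgue_measure]_(x in cell s) f x.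

Notation integrable_on D f := (lebesgue_measure.-integrable D (EFin \o f)).

Lemma integrable_cell {R : realType} (f : R -> R) s :
  integrable_on torus f -> integrable_on (cell s) f.
Proof.
apply: integrableS; [exact: measurable_itv|exact: measurable_itv|].
exact: cell_sub_torus.
Qed.

Lemma cell_average_martingale {R : realType} M (f : R -> R) :
  integrable_on torus f -> martingale M (cell_average f).
Proof.
move=> fi s _; rewrite /cell_average !size_rcons exprS cell_split Rintegral_setU.
- by field.
- exact: measurable_cell.
- exact: measurable_cell.
- by rewrite -cell_split; exact: integrable_cell.
- exact: cell_disjoint.
Qed.

Lemma mean_cell_average {R : realType} M (f : R -> R) :
  integrable_on torus f ->
  mean M (cell_average f) [::] = \int[lebesgue_measure]_(x in torus) f x.
Proof.
move=> fi; rewrite (stopped_mean_martingale (M := M) _ (cell_average_martingale fi))//.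
by rewrite /cell_average cell_nil expr0 mul1r.
Qed.

Lemma integrable_mul_walsh {R : realType} n (f : R -> R) :
  integrable_on torus f -> integrable_on torus (fun x => f x * walsh n x).
Proof.
move=> fi; apply: (@le_integrable _ _ R lebesgue_measure torus measurable_torus
  (EFin \o (fun x => f x * walsh n x)) (EFin \o f) _ _ fi).
- apply/measurable_EFinP; apply: measurable_funM.
    by apply/measurable_EFinP; exact: (measurable_int lebesgue_measure).
  exact: measurable_funTS (measurable_walsh n).
- by move=> x _ /=; rewrite lee_fin normrM ler_piMr// walsh_norm_le1.
Qed.

Lemma Rintegral_open_cell {R : realType} (f : R -> R) s :
  integrable_on (cell s) f ->
  \int[lebesgue_measure]_(x in cell s) f x =
  \int[lebesgue_measure]_(x in open_cell s) f x.
Proof.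
move=> fi; rewrite /cell -Rintegral_itv_obnd_cbnd//.
apply: integrableS fi => //; try exact: measurable_itv.
by apply: subset_itv; rewrite bnd_simp.
Qed.

Lemma cell_average_mul_walsh {R : realType} n (f : R -> R) s :
  integrable_on torus f -> (n < 2 ^ size s)%N ->
  cell_average (fun x => f x * walsh n x) s = cell_average f s * walsh_node n s.
Proof.
move=> fi ns; rewrite /cell_average -mulrA; congr (_ * _).
rewrite -RintegralZr; [|exact: measurable_itv|exact: integrable_cell].
have ci : integrable_on (cell s) f by exact: integrable_cell.
rewrite !Rintegral_open_cell; first last.
- exact/integrable_cell/integrable_mul_walsh.
- apply: (@le_integrable _ _ R lebesgue_measure _ (measurable_cell s)
    (EFin \o (fun x => f x * walsh_node n s)) (EFin \o f) _ _ ci).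
    apply/measurable_EFinP; apply: measurable_funM => //.
    by apply/measurable_EFinP; exact: (measurable_int lebesgue_measure).
  by move=> x _ /=; rewrite lee_fin normrM walsh_node_norm mulr1.
apply: eq_Rintegral => x /[!inE] xs; congr (_ * _).
exact: walsh_open_cell.
Qed.

Lemma walsh_coefficient {R : realType} M n (f : R -> R) :
  integrable_on torus f -> (n < 2 ^ M)%N ->
  \int[lebesgue_measure]_(x in torus) (f x * walsh n x) =
  node M (fun u => cell_average f u * walsh_node n u) [::].
Proof.
move=> fi nM; rewrite -(mean_cell_average M (integrable_mul_walsh n fi)).
rewrite /node subn0; apply: (mean_eq (M := M)) => // u uM.
by rewrite cell_average_mul_walsh ?uM.
Qed.

Lemma cell_average_norm_powR {R : realType} (p : R) (f : R -> R) s :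
  1 < p -> integrable_on torus f ->
  integrable_on torus (fun x => `|f x| `^ p) ->
  `|cell_average f s| `^ p <= cell_average (fun x => `|f x| `^ p) s.
Proof.
move=> p1 fi fpi; set c := cell_average (fun x => `|f x|) s.
have ai : integrable_on torus (fun x => `|f x|).
  exact: integrable_norm fi.
have e0 := exp2_gt0 (R := R) (size s).
have le : `|cell_average f s| <= c.
  rewrite /c /cell_average normrM (gtr0_norm e0) ler_pM2l//.
  apply: le_normr_Rintegral; [exact: measurable_cell|exact: integrable_cell].
have c0 : 0 <= c by exact: le_trans le.
apply: (@le_trans _ _ (c `^ p)).
  by rewrite ge0_ler_powR ?nnegrE//; lra.
apply: (powR_jensen_of_tangent p1 c0).
have mc : measurable (cell s : set R) by exact: measurable_cell.
have i1 : integrable_on (cell s) (fun x => `|f x| `^ p) by exact: integrable_cell.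
have i2 : integrable_on (cell s) (fun x => `|f x|) by exact: integrable_cell.
have icst (k : R) : integrable_on (cell s) (cst k).
  apply/integrableP; split; first by apply/measurable_EFinP; exact: measurable_cst.
  under eq_integral do rewrite /=.
  by rewrite integral_cst// [X in (_ * X)%E](lebesgue_measure_cell s) ltry.
have i3 : integrable_on (cell s) (fun x => `|f x| `^ p / p).
  rewrite (_ : EFin \o _ =
    ((EFin \o (fun x => (`|f x| `^ p)%R)) \* cst (p^-1)%R%:E)%E); first exact: integrableZr.
  by apply/funext => x /=; rewrite EFinM.
have key : \int[lebesgue_measure]_(x in cell s) (c `^ (p - 1) * `|f x|) <=
    \int[lebesgue_measure]_(x in cell s)
      (`|f x| `^ p / p + c `^ p / conj_exponent p).
  apply: le_Rintegral => //.
  - rewrite (_ : EFin \o _ = (fun x => (c `^ (p - 1))%R%:E * (EFin \o (fun x => `|f x|%R)) x)%E).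
      exact: integrableZl.
    by apply/funext => x /=; rewrite EFinM.
  - rewrite (_ : EFin \o _ = ((EFin \o (fun x => (`|f x| `^ p / p)%R)) \+
        (EFin \o cst (c `^ p / conj_exponent p)%R))%E).
      exact: integrableD.
    by apply/funext => x /=; rewrite EFinD.
  - by move=> x _; exact: young_tangent.
rewrite RintegralZl// RintegralD// in key; last exact: icst.
rewrite RintegralZr// Rintegral_cst// in key.
rewrite [X in fine X](lebesgue_measure_cell s)/= in key.
rewrite -(ler_pM2l e0) mulrDr in key.
rewrite [in leLHS]/c {2}/cell_average mulrCA; apply: le_trans key _.
by rewrite /cell_average mulrA lerD2l mulrCA divff ?mulr1//.
Qed.

(** The set need only be known inside the open cells: the left end points that are
left out have measure zero. *)
Lemma measure_le_mean {R : realType} M (B : pred (seq bool)) (X : set R) :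
  measurable X -> X `<=` torus ->
  (forall s x, size s = M -> open_cell s x -> X x -> B s) ->
  (lebesgue_measure X <= (mean M (fun s => (B s)%:R) [::])%:E)%E.
Proof.
move=> mX XT XB.
suff H n s : (size s + n = M)%N ->
    (lebesgue_measure (X `&` cell s) <=
      ((2 ^+ size s)^-1 * mean n (fun u => (B u)%:R) s)%:E)%E.
  have := H M [::] erefl; rewrite expr0 invr1 mul1r cell_nil.
  by have -> : X `&` torus = X by apply/setIidPl.
elim: n s => [|n IH] s sM /=.
  rewrite addn0 in sM; case: (boolP (B s)) => Bs.
    rewrite mulr1 -lebesgue_measure_cell; apply: le_measure; rewrite ?inE//.
      by apply: measurableI => //; exact: measurable_cell.
    exact: measurable_cell.
  rewrite mulr0; apply: (@le_trans _ _ (lebesgue_measure [set dyadic_left s : R]));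
    last by rewrite lebesgue_measure_set1.
  apply: le_measure; rewrite ?inE//.
    by apply: measurableI => //; exact: measurable_cell.
  move=> x [Xx]; rewrite /cell /= in_itv/= => /andP[].
  rewrite le_eqVlt => /predU1P[->//|x1 x2].
  exfalso; apply: (negP Bs); apply: (XB s x) => //.
  by rewrite /open_cell/= in_itv/= x1.
rewrite cell_split setIUr.
have m b : measurable (X `&` cell (rcons s b)).
  by apply: measurableI => //; exact: measurable_cell.
apply: (le_trans (measureU2 _ _ _)); [exact: m|exact: m|].
have h b : (lebesgue_measure (X `&` cell (rcons s b)) <=
    ((2 ^+ (size s).+1)^-1 * mean n (fun u => (B u)%:R) (rcons s b))%:E)%E.
  by have := IH (rcons s b); rewrite size_rcons addSnnS => /(_ sM).
apply: (le_trans (leeD (h false) (h true))).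
rewrite -EFinD lee_fin (half_exp2 (size s)).
by set x := mean _ _ _; set y := mean _ _ _; set z := (_ ^+ _)^-1; lra.
Qed.
(** * Blocks of a lacunary sequence *)

Lemma exists_power_ge {R : realType} (theta b : R) : 1 < theta ->
  exists2 L : nat, (0 < L)%N & b <= theta ^+ L.
Proof.
move=> t1.
have bern n : 1 + n%:R * (theta - 1) <= theta ^+ n.
  elim: n => [|n IH]; first by rewrite expr0; lra.
  rewrite exprS -natr1; have n0 : 0 <= n%:R :> R by [].
  have t0 : 0 <= theta by lra.
  have := ler_wpM2l t0 IH; have := mulr_ge0 n0 (sqr_ge0 (theta - 1)); lra.
pose m := Num.bound (`|b| / (theta - 1)).
have mb : `|b| / (theta - 1) < m%:R.
  by apply: archi_boundP; rewrite divr_ge0//; lra.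
exists m.+1 => //; apply: le_trans (bern m.+1).
rewrite ltr_pdivrMr in mb; last by lra.
have := ler_norm b; rewrite -natr1; nra.
Qed.

Lemma lacunary_growth {R : realType} (theta : R) (n_ : nat -> nat) i j :
  lacunary theta n_ -> theta ^+ i * (n_ j)%:R <= (n_ (j + i)%N)%:R.
Proof.
case=> pos inft t1; elim: i => [|i IH]; first by rewrite expr0 mul1r addn0.
rewrite exprS -mulrA addnS; have p := pos (j + i)%N.
apply: (@le_trans _ _ (theta * (n_ (j + i)%N)%:R)).
  by rewrite ler_pM2l//; lra.
rewrite -ler_pdivlMr ?ltr0n// -inft; apply: ge_inf; last by exists (j + i)%N.
by exists 0 => _ [k _ <-]; rewrite divr_ge0.
Qed.

(** Two indices that are congruent modulo [L] have terms in a ratio at least 4, so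
their successors cannot lie in the same dyadic block. The residue classes thus
give [L] sequences with one term in each block; blocks that contain no term
receive the dummy value 2^k. *)
Lemma lacunary_block_selection {R : realType} (theta : R) (n_ : nat -> nat) L :
  lacunary theta n_ -> (0 < L)%N -> 4 <= theta ^+ L ->
  exists N : nat -> nat -> nat,
    (forall r k, 2 ^ k <= N r k < 2 ^ k.+1)%N /\
    forall j, (n_ j).+1 = N (j %% L)%N (trunc_log 2 (n_ j).+1).
Proof.
move=> lac L0 L4; have [pos _ t1] := lac.
have sep i j : (i < j)%N -> i = j %[mod L] -> (4 * n_ i <= n_ j)%N.
  move=> ij ijL; rewrite -(ler_nat R) natrM.
  have jE : j = (i + (j - i))%N by rewrite subnKC// ltnW.
  rewrite jE; apply: le_trans (lacunary_growth (j - i) i lac).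
  rewrite ler_wpM2r//; apply: (le_trans L4).
  rewrite ler_weXn2l//; first exact: ltW.
  by rewrite dvdn_leq ?subn_gt0// -eqn_mod_dvd ?ijL// ltnW.
have uniq k i j : i = j %[mod L] -> (2 ^ k <= (n_ i).+1 < 2 ^ k.+1)%N ->
    (2 ^ k <= (n_ j).+1 < 2 ^ k.+1)%N -> i = j.
  wlog ij : i j / (i <= j)%N => [H|].
    by have [/H//|/ltnW/H h] := leqP i j => e bi bj; rewrite h.
  move: ij; rewrite leq_eqVlt => /predU1P[//|ij] e.
  have := sep _ _ ij e; have := pos i; rewrite expnS; lia.
have sel (rk : nat * nat) : exists N, (2 ^ rk.2 <= N < 2 ^ rk.2.+1)%N /\
    forall j, (j %% L = rk.1)%N -> (2 ^ rk.2 <= (n_ j).+1 < 2 ^ rk.2.+1)%N ->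
      (n_ j).+1 = N.
  case: rk => r k /=.
  have [[i [ir ib]]|no] := pselect (exists i, (i %% L)%N = r /\
      (2 ^ k <= (n_ i).+1 < 2 ^ k.+1)%N).
    exists (n_ i).+1; split => // j jr jb; congr (_.+1); congr n_.
    by apply: (uniq k) => //; rewrite ir jr.
  exists (2 ^ k)%N; split => [|j jr jb]; first by rewrite leqnn/= ltn_exp2l.
  by exfalso; apply: no; exists j.
have [N HN] := choice sel.
exists (fun r k => N (r, k)); split => [r k|j]; first by case: (HN (r, k)).
have [_ H] := HN ((j %% L)%N, trunc_log 2 (n_ j).+1).
by apply: H => //=; exact: trunc_log_bounds.
Qed.
(** * Complex functions and Lebesgue norms *)

Lemma ReIm_mul_realC {R : realType} (z : R[i]) (w : R) :
  complex.Re (z * w%:C%C) = complex.Re z * w /\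
  complex.Im (z * w%:C%C) = complex.Im z * w.
Proof. by case: z => a b; split; rewrite /= ?mulr0 ?subr0 ?add0r ?addr0. Qed.

Lemma ReIm_walsh_sum {R : realType} n (f : R -> R[i]) (x : R) :
  complex.Re (walsh_sum n f x) = \sum_(k < n.+1)
    \int[lebesgue_measure]_(y in torus) (complex.Re (f y) * walsh k y) * walsh k x /\
  complex.Im (walsh_sum n f x) = \sum_(k < n.+1)
    \int[lebesgue_measure]_(y in torus) (complex.Im (f y) * walsh k y) * walsh k x.
Proof.
rewrite /walsh_sum big_mkord; elim: n.+1 => [|m [IHr IHi]].
  by rewrite !big_ord0.
have innerE : inner f (cwalsh m) = Complex
    (\int[lebesgue_measure]_(y in torus) (complex.Re (f y) * walsh m y))
    (\int[lebesgue_measure]_(y in torus) (complex.Im (f y) * walsh m y)).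
  rewrite /inner /cintegral; congr Complex; apply: eq_Rintegral => y _;
    rewrite /cwalsh; case: (f y) => a b /=; rewrite oppr0 mulr0.
    by rewrite subr0.
  by rewrite add0r.
rewrite !big_ord_recr/= -IHr -IHi innerE {1 3}/cwalsh.
have [re im] := ReIm_mul_realC (Complex
    (\int[lebesgue_measure]_(y in torus) (complex.Re (f y) * walsh m y))
    (\int[lebesgue_measure]_(y in torus) (complex.Im (f y) * walsh m y))) (walsh m x).
split.
  by rewrite -[in RHS]re; case: (\sum_(i < m) _) => a b.
by rewrite -[in RHS]im; case: (\sum_(i < m) _) => a b.
Qed.

Lemma walsh_sum_open_cell {R : realType} M n (u : R -> R) s (x : R) :
  integrable_on torus u -> size s = M -> (n.+1 <= 2 ^ M)%N -> open_cell s x ->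
  \sum_(k < n.+1)
    \int[lebesgue_measure]_(y in torus) (u y * walsh k y) * walsh k x =
  walsh_partial_sum M n.+1 (cell_average u) s.
Proof.
move=> ui sM nM xs; rewrite /walsh_partial_sum; apply: eq_bigr => k _.
have kM : (k < 2 ^ M)%N by rewrite (leq_trans _ nM).
by rewrite (walsh_coefficient ui kM) (walsh_open_cell _ xs) ?sM.
Qed.

Lemma normc_le_ReIm {R : realType} (z : R[i]) :
  [/\ `|complex.Re z| <= Normc.normc z, `|complex.Im z| <= Normc.normc z &
      Normc.normc z <= `|complex.Re z| + `|complex.Im z|].
Proof.
case: z => a b /=; split.
- by rewrite -sqrtr_sqr ler_wsqrtr// lerDl sqr_ge0.
- by rewrite -sqrtr_sqr ler_wsqrtr// lerDr sqr_ge0.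
- have ab : 0 <= `|a| + `|b| by rewrite addr_ge0.
  rewrite -[leRHS]ger0_norm// -[leRHS]sqrtr_sqr ler_wsqrtr// sqrrD !real_normK ?num_real//.
  by rewrite lerD2r lerDl mulrn_wge0// mulr_ge0.
Qed.

Lemma measurable_normc {R : realType} (D : set R) (f : R -> R[i]) :
  measurable_fun D (fun x => complex.Re (f x)) ->
  measurable_fun D (fun x => complex.Im (f x)) ->
  measurable_fun D (fun x => Normc.normc (f x)).
Proof.
move=> mr mi.
have -> : (fun x => Normc.normc (f x)) = (fun x => Num.sqrt
    (complex.Re (f x) ^+ 2 + complex.Im (f x) ^+ 2)).
  by apply/funext => x; case: (f x).
have ms : measurable_fun [set: R] (Num.sqrt : R -> R).
  by apply: continuous_measurable_fun; exact: sqrt_continuous.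
apply: (measurableT_comp ms).
by apply: measurable_funD; apply: measurable_funX.
Qed.

Lemma measurable_walsh_sum {R : realType} n (f : R -> R[i]) :
  measurable_fun torus (fun x : R => Normc.normc (walsh_sum n f x)).
Proof.
apply: measurable_normc.
  under eq_fun do rewrite (ReIm_walsh_sum n f _).1.
  apply: measurable_sum => k; apply: measurable_funM => //.
  exact: measurable_funTS (measurable_walsh k).
under eq_fun do rewrite (ReIm_walsh_sum n f _).2.
apply: measurable_sum => k; apply: measurable_funM => //.
exact: measurable_funTS (measurable_walsh k).
Qed.

Lemma Lpnorm_powR {R : realType} (p : R) (f : R -> R[i]) : 0 < p ->
  (Lpnorm p f `^ p)%E =
  (\int[lebesgue_measure]_(x in torus) ((Normc.normc (f x)) `^ p)%:E)%E.
Proof.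
move=> p0; rewrite /Lpnorm poweR_Lnorm ?gt_eqF// [RHS]integral_mkcond.
apply: eq_integral => x _; rewrite /patch; case: ifP => _.
  rewrite gee0_abs ?poweR_EFin// lee_fin.
  by have [+ _ _] := normc_le_ReIm (f x); exact: le_trans.
by rewrite abse0 poweR0r// gt_eqF.
Qed.
Lemma in_Lp_integral {R : realType} (p : R) (f : R -> R[i]) : 1 < p -> in_Lp p f ->
  integrable_on torus (fun x => Normc.normc (f x) `^ p) /\
  \int[lebesgue_measure]_(x in torus) (Normc.normc (f x) `^ p) =
    fine (Lpnorm p f) `^ p.
Proof.
move=> p1 [[mr mi] fin]; have p0 : 0 < p by lra.
have fn : Lpnorm p f \is a fin_num by rewrite ge0_fin_numE ?Lnorm_ge0.
have e := Lpnorm_powR f p0.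
split; last first.
  by rewrite /Rintegral -e -{1}(fineK fn) poweR_EFin.
apply/integrableP; split.
  apply/measurable_EFinP; apply: (measurableT_comp (measurable_powR p)).
  exact: measurable_normc.
under eq_integral do rewrite gee0_abs ?lee_fin ?powR_ge0//=.
by rewrite -e -(fineK fn) poweR_EFin ltry.
Qed.

(** Used for the real and the imaginary part. Integrability follows from
|u| <= 1 + |u|^p. *)
Lemma dominated_in_Lp {R : realType} (p : R) (f : R -> R[i]) (u : R -> R) :
  1 < p -> in_Lp p f -> measurable_fun torus u ->
  (forall x, `|u x| <= Normc.normc (f x)) ->
  [/\ integrable_on torus u, integrable_on torus (fun x => `|u x| `^ p) &
    \int[lebesgue_measure]_(x in torus) (`|u x| `^ p) <= fine (Lpnorm p f) `^ p].
Proof.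
move=> p1 fp mu uf; have [fi fE] := in_Lp_integral p1 fp.
have le x : `|u x| `^ p <= Normc.normc (f x) `^ p.
  have := uf x => ux; rewrite ge0_ler_powR ?nnegrE//; first by lra.
  exact: le_trans ux.
have mp : measurable_fun torus (fun x => `|u x| `^ p).
  apply: (measurableT_comp (measurable_powR p)).
  exact: measurableT_comp.
have ip : integrable_on torus (fun x => `|u x| `^ p).
  refine (@le_integrable _ _ R lebesgue_measure torus measurable_torus
    (EFin \o (fun x => `|u x| `^ p))
    (EFin \o (fun x => Normc.normc (f x) `^ p)) _ _ fi).
    exact/measurable_EFinP.
  by move=> x _ /=; rewrite lee_fin !(ger0_norm (powR_ge0 _ _)).
split => //; last first.
  by rewrite -fE; apply: le_Rintegral => //; exact: measurable_torus.
have i1 : integrable_on torus (cst (1 : R)).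
  apply/integrableP; split; first by apply/measurable_EFinP; exact: measurable_cst.
  under eq_integral do rewrite /=.
  rewrite integral_cst; last exact: measurable_torus.
  by rewrite -cell_nil [X in (_ * X)%E](lebesgue_measure_cell [::]) ltry.
refine (@le_integrable _ _ R lebesgue_measure torus measurable_torus
    (EFin \o u) ((EFin \o cst 1%R) \+ (EFin \o (fun x => (`|u x| `^ p)%R)))%E _ _ _).
- exact/measurable_EFinP.
- move=> x _ /=; rewrite lee_fin [leRHS]ger0_norm; last first.
    by rewrite addr_ge0// powR_ge0.
  have [u1|u1] := leP `|u x| 1; first by have := powR_ge0 `|u x| p; lra.
  by have := le1r_powR (ltW u1) (ltW p1); lra.
- by apply: integrableD => //; exact: measurable_torus.
Qed.

Lemma mean_cell_average_powR_le {R : realType} (p : R) (f : R -> R[i]) (u : R -> R) M :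
  1 < p -> in_Lp p f -> measurable_fun torus u ->
  (forall x, `|u x| <= Normc.normc (f x)) ->
  mean M (fun s => `|cell_average u s| `^ p) [::] <= fine (Lpnorm p f) `^ p.
Proof.
move=> p1 fp mu uf; have [ui up ule] := dominated_in_Lp p1 fp mu uf.
apply: le_trans ule; rewrite -(mean_cell_average M up).
apply: (stopped_mean_mono (M := M)) => // s _ _ _.
exact: cell_average_norm_powR.
Qed.

(** * Level sets of the maximal function *)

Lemma measurable_walsh_level_set {R : realType} (lambda : R) n (f : R -> R[i]) :
  measurable (torus `&` [set x | lambda < Normc.normc (walsh_sum n f x)]).
Proof.
have mI : measurable (`]lambda, +oo[ : set R) by exact: measurable_itv.
have := measurable_walsh_sum n f measurable_torus mI.
by congr measurable; apply/seteqP; split => x /=; rewrite in_itv/= andbT.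
Qed.

(** One of the two parts of the partial sum exceeds [lambda / 2]; this accounts for
128 = 2 * 64, and the union over the two parts for 150 = 2 * 75. The factor [L] is the number of residue classes. *)
Lemma walsh_finite_level_set {R : realType} (p lambda : R) (f : R -> R[i])
    (n_ : nat -> nat) L (N : nat -> nat -> nat) J :
  1 < p -> p <= 2 -> 0 < lambda -> in_Lp p f -> (0 < L)%N ->
  (forall r k, 2 ^ k <= N r k < 2 ^ k.+1)%N ->
  (forall j, (n_ j).+1 = N (j %% L)%N (trunc_log 2 (n_ j).+1)) ->
  (lebesgue_measure (\big[setU/set0]_(j < J)
      (torus `&` [set x | (lambda < Normc.normc (walsh_sum (n_ j) f x))%R])) <=
    (150 * L%:R * (128 * log1 (conj_exponent p) / lambda) `^ p *
      fine (Lpnorm p f) `^ p)%:E)%E.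
Proof.
move=> p1 p2 l0 fp L0 hN selN.
have [[mr mi] _] := fp.
have re x : `|complex.Re (f x)| <= Normc.normc (f x) by have [] := normc_le_ReIm (f x).
have im x : `|complex.Im (f x)| <= Normc.normc (f x) by have [] := normc_le_ReIm (f x).
pose M := \max_(j < J) (n_ j).+1.
have nM j : (j < J)%N -> ((n_ j).+1 < 2 ^ M)%N.
  move=> jJ; apply: (@leq_ltn_trans M); last exact: ltn_expl.
  exact: (leq_bigmax (Ordinal jJ)).
pose e u r s := [exists k : 'I_M,
  lambda / 2 < `|walsh_partial_sum M (N r k) (cell_average u) s|].
pose u x := complex.Re (f x); pose v x := complex.Im (f x).
pose B s := [exists r : 'I_L, e u r s || e v r s].
pose Y j := torus `&` [set x : R | lambda < Normc.normc (walsh_sum (n_ j) f x)].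
rewrite -(bigcup_mkord J Y).
have [ui _ _] := dominated_in_Lp p1 fp mr re.
have [vi _ _] := dominated_in_Lp p1 fp mi im.
apply: le_trans (measure_le_mean (M := M) (B := B) _ _ _) _.
- by apply: bigcup_measurable => j _; exact: measurable_walsh_level_set.
- by move=> x [j _ []].
- move=> s x sM xs [j /= jJ [_ /= big]].
  pose k := trunc_log 2 (n_ j).+1.
  have kM : (k < M)%N.
    rewrite -(@ltn_exp2l 2)//; apply: leq_ltn_trans (nM _ jJ).
    by have /andP[] := @trunc_log_bounds 2 (n_ j).+1 erefl erefl.
  have rL : (j %% L < L)%N by rewrite ltn_mod.
  apply/existsP; exists (Ordinal rL); rewrite /e /=.
  have [eR eI] := ReIm_walsh_sum (n_ j) f x.
  rewrite (walsh_sum_open_cell ui sM (ltnW (nM _ jJ)) xs) in eR.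
  rewrite (walsh_sum_open_cell vi sM (ltnW (nM _ jJ)) xs) in eI.
  have [_ _] := normc_le_ReIm (walsh_sum (n_ j) f x).
  rewrite eR eI; set Su := walsh_partial_sum M _ (cell_average _) s.
  set Sv := walsh_partial_sum M _ (cell_average _) s => le.
  have [hu|hu] := ltP (lambda / 2) `|Su|.
    by apply/orP; left; apply/existsP; exists (Ordinal kM); rewrite /= -selN.
  apply/orP; right; apply/existsP; exists (Ordinal kM); rewrite /= -selN.
  suff : lambda / 2 < `|Sv| by [].
  lra.
rewrite lee_fin; set c := (_ / _) `^ p; set D := _ `^ p.
have weak (w : R -> R) : measurable_fun torus w -> (forall x, `|w x| <= Normc.normc (f x)) ->
    forall r, mean M (fun s => (e w r s)%:R) [::] <= 75 * c * D.
  move=> mw wf r; have l2 : 0 < lambda / 2 by lra.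
  apply: (le_trans (dyadic_lacunary_weak_type _ _ p1 p2 l2 (hN r))).
  have -> : 64 * log1 (conj_exponent p) / (lambda / 2) =
      128 * log1 (conj_exponent p) / lambda by field; rewrite gt_eqF.
  rewrite ler_wpM2l ?mulr_ge0 ?powR_ge0//.
  exact: mean_cell_average_powR_le.
apply: (@le_trans _ _ (mean M (fun s =>
    \sum_(r < L) ((e u r s)%:R + (e v r s)%:R)) [::])).
  apply: (stopped_mean_mono (M := M)) => // s _ _ _.
  rewrite /B; case: existsP => [[r er]|_]; last first.
    by apply: sumr_ge0 => r _; rewrite addr_ge0.
  rewrite (bigD1 r)//= ler_wpDr//.
    by apply: sumr_ge0 => i _; rewrite addr_ge0.
  by case/orP: er => ->; rewrite ?lerDl ?lerDr.
rewrite (stopped_mean_sum predT M L (fun r s => (e u r s)%:R + (e v r s)%:R)).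
apply: (@le_trans _ _ (\sum_(r < L) (150 * c * D))).
  apply: ler_sum => r _; rewrite stopped_meanD.
  by have := weak u mr re r; have := weak v mi im r; lra.
by rewrite sumr_const card_ord -[leLHS]mulr_natr; lra.
Qed.

(** Continuity from below of the measure, as the bound for finitely many indices does
not depend on their number. *)
Lemma walsh_max_level_set {R : realType} (p lambda : R) (f : R -> R[i])
    (n_ : nat -> nat) L (N : nat -> nat -> nat) :
  1 < p -> p <= 2 -> 0 < lambda -> in_Lp p f -> (0 < L)%N ->
  (forall r k, 2 ^ k <= N r k < 2 ^ k.+1)%N ->
  (forall j, (n_ j).+1 = N (j %% L)%N (trunc_log 2 (n_ j).+1)) ->
  (lebesgue_measure (torus `&` [set x | (lambda%:E < `|walsh_max n_ f x|)%E]) <=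
    (150 * L%:R * (128 * log1 (conj_exponent p) / lambda) `^ p *
      fine (Lpnorm p f) `^ p)%:E)%E.
Proof.
move=> p1 p2 l0 fp L0 hN selN.
pose Y j := torus `&` [set x : R | lambda < Normc.normc (walsh_sum (n_ j) f x)].
have mY j : measurable (Y j) by exact: measurable_walsh_level_set.
have norm0 (z : R[i]) : 0 <= Normc.normc z.
  by have [+ _ _] := normc_le_ReIm z; exact: le_trans.
have -> : torus `&` [set x | (lambda%:E < `|walsh_max n_ f x|)%E] =
    \bigcup_J \big[setU/set0]_(j < J.+1) Y j.
  rewrite bigcup_bigsetU_bigcup; apply/seteqP; split => x /=.
    move=> [Tx]; rewrite gee0_abs.
      by move=> /ereal_sup_gt[_ [_ [j _ <-] <-]]; rewrite lte_fin => h; exists j.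
    apply: le_ereal_sup_tmp; exists (Normc.normc (walsh_sum (n_ 0) f x))%:E.
      by exists (n_ 0%N) => //; exists 0%N.
    by rewrite lee_fin.
  move=> [j _ [Tx h]]; split => //; apply: lt_le_trans (lee_abs _).
  apply: (@lt_le_trans _ _ (Normc.normc (walsh_sum (n_ j) f x))%:E).
    by rewrite lte_fin.
  by apply: ereal_sup_ubound; exists (n_ j) => //; exists j.
have mZ J : measurable (\big[setU/set0]_(j < J.+1) Y j).
  by apply: bigsetU_measurable => j _; exact: mY.
have mono : {homo (fun J => \big[setU/set0]_(j < J.+1) Y j) : m n / (m <= n)%N >-> (m <= n)%O}.
  by move=> m n mn; apply/subsetPset; apply: subset_bigsetU.
have cv := @nondecreasing_cvg_mu _ _ _ lebesgue_measure
  (fun J => \big[setU/set0]_(j < J.+1) Y j) mZ (bigcup_measurable (fun J _ => mZ J))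
  mono.
rewrite -(cvg_lim _ cv)//; apply: lime_le; first by apply/cvg_ex; eexists; exact: cv.
apply: nearW => J; exact: walsh_finite_level_set.
Qed.

Theorem theorem1p2 (R : realType) (theta : R) :
  exists K : R, 0 < K /\
    forall n_ : nat -> nat, lacunary theta n_ ->
    forall p : R, 1 < p -> p <= 2 ->
    forall f : R -> R[i], in_Lp p f ->
      (weak_Lpnorm p (walsh_max n_ f)
        <= (K * log1 (conj_exponent p))%:E * Lpnorm p f)%E.
Proof.
(* No sequence is lacunary with such a constant. *)
have [t1|t1] := leP theta 1.
  exists 1; split => // n_ [_ _]; rewrite ltNge t1; done.
have [L L0 L4] := exists_power_ge 4 t1.
exists (150 * L%:R * 128); split; first by rewrite !mulr_gt0 ?ltr0n.
move=> n_ lac p p1 p2 f fp.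
have [N [hN selN]] := lacunary_block_selection lac L0 L4.
have fn : Lpnorm p f \is a fin_num by rewrite ge0_fin_numE ?Lnorm_ge0; case: fp.
have D0 : 0 <= fine (Lpnorm p f) by rewrite fine_ge0// Lnorm_ge0.
have p0 : 0 < p by lra.
have l1 : 1 <= log1 (conj_exponent p).
  by apply: log1_ge1; have := conj_exponent_ge2 p1 p2; lra.
apply: ge_ereal_sup => _ [lambda /= l0 <-].
have := walsh_max_level_set p1 p2 l0 fp L0 hN selN.
set c := 150 * L%:R; set A := 128 * _ / _; set D := fine _.
have c1 : 1 <= c.
  have : 1 <= L%:R :> R by rewrite ler1n.
  rewrite /c; lra.
have A0 : 0 <= A by rewrite divr_ge0 ?mulr_ge0 ?ltW//; lra.
have B0 : 0 <= c * A `^ p * D `^ p.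
  by rewrite !mulr_ge0 ?powR_ge0//; lra.
set X := torus `&` _ => le.
have {le} root : (lebesgue_measure X `^ p^-1 <= (c * A * D)%:E)%E.
  apply: (@le_trans _ _ ((c * A `^ p * D `^ p)%:E `^ p^-1)%E).
    apply: gt0_ler_poweR => //; first by rewrite invr_ge0 ltW.
      by rewrite in_itv/= measure_ge0 leey.
    by rewrite in_itv/= lee_fin B0 leey.
  have c0 : 0 <= c by lra.
  have AD0 : 0 <= A * D by rewrite mulr_ge0.
  have -> : c * A `^ p * D `^ p = c * (A * D) `^ p by rewrite (powRM _ A0 D0) mulrA.
  rewrite poweR_EFin lee_fin -(mulrA c).
  rewrite (powRM _ c0 (powR_ge0 _ _)) -powRrM mulfV ?gt_eqF// powRr1// ler_wpM2r//.
  rewrite -[leRHS]powRr1//; apply: ler_powR => //.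
  by rewrite invf_le1//; lra.
have := lee_wpmul2l (_ : 0 <= lambda%:E)%E root; rewrite lee_fin => /(_ (ltW l0)).
move=> /le_trans; apply; rewrite -(fineK fn) -!EFinM lee_fin -/D.
rewrite le_eqVlt; apply/orP; left; apply/eqP.
by rewrite /A; field; rewrite gt_eqF.
Qed.
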